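(* Let $r$, $K$, $L$ be positive integers with $K\geq 2$. As $n\to\infty$ through elements of $F_r$: (a) $\displaystyle\limsup_{n\to\infty}\frac{P_1(n)}{\log n}\geq 2$; (b) $\displaystyle\limsup_{n\to\infty}\frac{Q_L(n)}{\log n}=1$; (c) $\displaystyle\limsup_{n\to\infty}\frac{P_K(n)}{\log n}\leq \lambda_K(r)^{-1}$, where the limsup is over those $n\in F_r$ with $\omega(n)\geq K$; (d) $\displaystyle\limsup_{n\to\infty}\frac{P_1(n)}{\log^2 n}\leq \frac{J_r}{r}$.
   Context: For a positive integer $r$, $S_r$ is the multiplicative arithmetic function with $S_r(p^{\alpha})=0$ if $p\leq r$ and $S_r(p^{\alpha})=p^{\alpha-1}(p-r)$ if $p>r$, for all primes $p$ and positive integers $\alpha$. $B_r=\{n\in\mathbb{N}: S_r(n)>0\}$ (positive integers whose smallest prime factor exceeds $r$, together with $1$). $F_r$ is the set of $n\in B_r$ such that $S_r(n)<S_r(m)$ for all $m\in B_r$ with $m>n$. $\omega(n)$ is the number of distinct prime factors of $n$. For $n\in F_r$, $P_k(n)$ is the $k$-th largest prime divisor of $n$ (when $\omega(n)\geq k$), and $Q_k(n)$ is the $k$-th smallest prime that is larger than $r$ and does not divide $n$. $r\#$ is the product of all primes $\leq r$ (with $1\#=1$). The Jacobsthal function $J(m)$ is the smallest positive integer $a$ such that every set of $a$ consecutive integers contains an element coprime to $m$; $J_r=J(r\#)$. $\lambda_k(r)$ is the unique positive real root of the polynomial $\frac{J_r}{r}x^k+kx-(k-1)$. *)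

(* Defs.v *)
From Stdlib Require Import Reals ZArith.
From mathcomp Require Import all_boot.

Set Implicit Arguments.
Unset Strict Implicit.
Unset Printing Implicit Defensive.

(* S_r: multiplicative, S_r(p^a) = 0 if p <= r, p^(a-1)(p-r) if p > r.
   n = 0 is outside the domain; we set S_r 0 = 0. *)
Definition Sr (r n : nat) : nat :=
  if n == 0 then 0
  else \prod_(p <- primes n) (if p <= r then 0 else p ^ (logn p n).-1 * (p - r)).

Definition inB (r n : nat) : bool := (0 < n) && (0 < Sr r n).

Definition inF (r n : nat) : Prop :=
  inB r n /\ (forall m : nat, inB r m -> n < m -> Sr r n < Sr r m).

Definition omega (n : nat) : nat := size (primes n).

(* P_k(n): k-th largest prime divisor of n (k >= 1, meaningful when omega n >= k) *)
Definition Pk (k n : nat) : nat := nth 0 (rev (primes n)) k.-1.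

(* Q_k(n): k-th smallest prime > r not dividing n.  Built by iterating
   "least prime > m not dividing n" starting from m = r.
   (The disjunct n == 0 only makes the search total; n in F_r is positive.) *)
Lemma next_prime_ex (n m : nat) :
  exists p, [&& m < p, prime p & (n == 0) || ~~ (p %| n)].
Proof.
case: (prime_above (maxn m n)) => p Hp pr; exists p.
rewrite pr /=; rewrite gtn_max in Hp; case/andP: Hp => -> Hnp /=.
case: n Hnp => [//|n] Hnp /=.
by rewrite gtnNdvd.
Qed.

Definition next_nondiv_prime (n m : nat) : nat := ex_minn (next_prime_ex n m).

Definition Qk (r k n : nat) : nat := ssrnat.iter k (next_nondiv_prime n) r.

Definition primorial (r : nat) : nat := \prod_(p < r.+1 | prime p) p.

Definition covers (m a : nat) : Prop :=
  forall x : Z, exists i : nat, (i < a)%N /\ Z.gcd (x + Z.of_nat i) (Z.of_nat m) = 1%Z.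

Definition is_jacobsthal (m a : nat) : Prop :=
  (0 < a)%N /\ covers m a /\ (forall b : nat, (0 < b)%N -> covers m b -> (a <= b)%N).

Definition limsup_ge (S : nat -> Prop) (f : nat -> R) (c : R) : Prop :=
  forall eps : R, Rlt 0 eps ->
  forall N : nat, exists n : nat, (N <= n)%N /\ S n /\ Rlt (Rminus c eps) (f n).

Definition limsup_le (S : nat -> Prop) (f : nat -> R) (c : R) : Prop :=
  forall eps : R, Rlt 0 eps ->
  exists N : nat, forall n : nat, (N <= n)%N -> S n -> Rlt (f n) (Rplus c eps).

(* Main.v *)
(** Everything rests on the prime number theorem. It is proved by the Erdos-Selberg method:
    with R(n) = psi(n) - n, Selberg's formula R(N) log N + sum_k Lambda(k) R(N/k) = O(N) is
    iterated once, which gives |R(N)| log^2 N <= 2 sum_n log n |R(N/n)| + O(N log N). Since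
    sum R(n)/n^2 is bounded, R is small at some point of every interval [y, cy], hence on a
    short interval around it, so that a bound |R(N)| <= aN improves by a fixed factor.

    For the theorem, let q_0 < q_1 < ... be the primes above r. The numbers q_0 ... q_(k-1) q'
    with q' a prime close to, and below, 2 q_k belong to F_r and satisfy log n ~ q_k, which
    gives (a) and the lower bound in (b). The upper bound in (b) holds for every n, because all
    but L - 1 of the primes between r and Q_L(n) divide n. For (c) and (d), the product of the
    K largest primes of n (resp. of P_1) is replaced by Q_1 ... Q_(K-1) t (resp. Q_1 t), where
    t is the least integer coprime to r# making the new number larger than n; membership in
    F_r forces S_r to increase, and comparing both sides to first order in 1/Q bounds P_K. *)

From HB Require Import structures.
Require Import Defs.
From Stdlib Require Import Reals ZArith Lra Psatz.
From mathcomp Require Import all_boot.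
From mathcomp Require Import zify.

Set Implicit Arguments.
Unset Strict Implicit.
Unset Printing Implicit Defensive.

Local Open Scope R_scope.

(** The estimate |R(N)| log^2 N <= 2 sum_n log n |R(N/n)| + O(N log N) is exactly balanced:
    inserting |R(m)| <= a m returns the same a, because 2 sum_n (log n)/n ~ log^2 N. So a saving on
    a set of n of positive logarithmic density lowers a; for the iteration to converge, the gain
    must depend only on a lower bound for a. The sharp constant matters: (a) asks for a prime in (2x
    - x/D, 2x - r) for every fixed D, and (b) for theta(x) ~ x.

    An exchange of primes is profitable because each prime factor loses r under S_r, while the
    filler t contributes at most a factor t. The ideal t is the quotient of the two products;
    rounding it up to an integer free of primes <= r overshoots by at most J_r. With P = P_K, Q =
    Q_(K-1) and x = Q/P this yields (1 - K r/P)(1 + (K-1) r/Q) < 1 + J_r Q^(K-1)/P^K. Division by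
    r/Q leaves K - 1 < (J_r/r) x^K + K x + O(x/Q), whence the polynomial of lambda_K(r): x is
    asymptotically at least lambda_K(r), while Q <= (1 + o(1)) log n. *)

HB.instance Definition _ := Monoid.isComLaw.Build R 0 Rplus
  (fun x y z => esym (Rplus_assoc x y z)) Rplus_comm Rplus_0_l.
HB.instance Definition _ := Monoid.isComLaw.Build R 1 Rmult
  (fun x y z => esym (Rmult_assoc x y z)) Rmult_comm Rmult_1_l.

(** * Sums over 1 <= i <= N *)

Notation "\rsum_ ( i <= N ) F" := (\big[Rplus/0]_(1 <= i < N.+1) F)
  (at level 41, F at level 41, i name, N at level 50,
   format "'[' \rsum_ ( i  <=  N ) '/  '  F ']'").

Lemma rsum0 (F : nat -> R) : \rsum_(i <= 0) F i = 0.
Proof. by rewrite big_geq. Qed.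

Lemma rsumS n (F : nat -> R) : \rsum_(i <= n.+1) F i = \rsum_(i <= n) F i + F n.+1.
Proof. by rewrite big_nat_recr. Qed.

Lemma eq_rsum n (F G : nat -> R) : (forall i, (0 < i <= n)%N -> F i = G i) ->
  \rsum_(i <= n) F i = \rsum_(i <= n) G i.
Proof. by move=> E; apply: eq_big_nat. Qed.

Lemma ler_rsum n (F G : nat -> R) : (forall i, (0 < i <= n)%N -> F i <= G i) ->
  \rsum_(i <= n) F i <= \rsum_(i <= n) G i.
Proof.
elim: n => [|n IH] le; first by rewrite !rsum0; lra.
rewrite !rsumS; apply: Rplus_le_compat; last by apply: le; lia.
by apply: IH => i hi; apply: le; lia.
Qed.

Lemma rsum_const n c : \rsum_(i <= n) c = INR n * c.
Proof. by elim: n => [|n IH]; rewrite ?rsum0 ?rsumS ?S_INR ?IH /=; lra. Qed.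

Lemma rsum_ge0 n (F : nat -> R) : (forall i, (0 < i <= n)%N -> 0 <= F i) ->
  0 <= \rsum_(i <= n) F i.
Proof.
move=> F0; have := @ler_rsum n (fun=> 0) F F0.
by rewrite rsum_const; lra.
Qed.

Lemma rsumD n (F G : nat -> R) :
  \rsum_(i <= n) (F i + G i) = \rsum_(i <= n) F i + \rsum_(i <= n) G i.
Proof. exact: big_split. Qed.

Lemma rsumZ n c (F : nat -> R) :
  \rsum_(i <= n) (c * F i) = c * \rsum_(i <= n) F i.
Proof. by elim: n => [|n IH]; rewrite ?rsum0 ?rsumS ?IH; lra. Qed.

Lemma rsumB n (F G : nat -> R) :
  \rsum_(i <= n) (F i - G i) = \rsum_(i <= n) F i - \rsum_(i <= n) G i.
Proof. by elim: n => [|n IH]; rewrite ?rsum0 ?rsumS ?IH; lra. Qed.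

Lemma rsum_abs n (F : nat -> R) :
  Rabs (\rsum_(i <= n) F i) <= \rsum_(i <= n) Rabs (F i).
Proof.
elim: n => [|n IH]; first by rewrite !rsum0 Rabs_R0; lra.
by rewrite !rsumS; apply: Rle_trans (Rabs_triang _ _) _; lra.
Qed.

Lemma rsum_exchange m n (F : nat -> nat -> R) :
  \rsum_(i <= m) \rsum_(j <= n) F i j = \rsum_(j <= n) \rsum_(i <= m) F i j.
Proof. exact: exchange_big. Qed.

Lemma rsum_widen m n (F : nat -> R) : (m <= n)%N ->
  (forall i, (m < i <= n)%N -> F i = 0) ->
  \rsum_(i <= n) F i = \rsum_(i <= m) F i.
Proof.
move=> lemn F0; rewrite (big_cat_nat (n := m.+1)) //=.
rewrite [X in _ + X](_ : _ = 0) ?Rplus_0_r //.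
by rewrite big_nat; apply: big1 => i hi; apply: F0; lia.
Qed.

Lemma rsum_single n k (F : nat -> R) : (0 < k <= n)%N ->
  \rsum_(i <= n) (if i == k then F i else 0) = F k.
Proof.
case: k => // k hk; rewrite (@rsum_widen k.+1) => [|| i hi]; try lia; last first.
  by case: eqP => // e; lia.
rewrite rsumS eqxx (eq_rsum (G := fun=> 0)) ?rsum_const; first lra.
by move=> i hi; case: eqP => // e; lia.
Qed.

(** Partial summation with the boundary term at n + 1 instead of n: for weights depending on N %/ n
    it vanishes at n = N. *)
Lemma rsum_abel n (w g : nat -> R) :
  \rsum_(i <= n) (w i * g i) =
  \rsum_(i <= n) ((\rsum_(j <= i) w j) * (g i - g i.+1)) + (\rsum_(j <= n) w j) * g n.+1.
Proof. by elim: n => [|n IH]; rewrite ?rsum0 ?(rsumS n) ?IH; lra. Qed.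

Lemma rsum_multiples N d (G : nat -> R) : (0 < d)%N ->
  \rsum_(n <= N) (if d %| n then G n else 0) = \rsum_(m <= N %/ d) G (d * m)%N.
Proof.
move=> d0; elim: N => [|N IH]; first by rewrite div0n !rsum0.
rewrite rsumS IH divnS //; case: ifP => dv; last by rewrite add0n; lra.
rewrite add1n rsumS; congr (_ + G _).
have := divnK dv; rewrite divnS // dv add1n; lia.
Qed.

Lemma rsum_divisors N (F : nat -> nat -> R) :
  \rsum_(n <= N) \rsum_(d <= n) (if d %| n then F d n else 0) =
  \rsum_(d <= N) \rsum_(m <= N %/ d) F d (d * m)%N.
Proof.
transitivity (\rsum_(n <= N) \rsum_(d <= N) (if d %| n then F d n else 0)).
  apply: eq_rsum => n hn; symmetry; apply: rsum_widen; first lia.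
  move=> d hd; case: ifP => // /dvdn_leq; lia.
rewrite rsum_exchange; apply: eq_rsum => d hd.
by rewrite (rsum_multiples N (F d)) //; lia.
Qed.

(** Both sides run over the pairs with d m <= N. *)
Lemma rsum_hyperbola N (F : nat -> nat -> R) :
  \rsum_(d <= N) \rsum_(m <= N %/ d) F d m = \rsum_(m <= N) \rsum_(d <= N %/ m) F d m.
Proof.
have H (G : nat -> nat -> R) : \rsum_(d <= N) \rsum_(m <= N %/ d) G d m =
    \rsum_(d <= N) \rsum_(m <= N) (if (d * m <= N)%N then G d m else 0).
  apply: eq_rsum => d hd; rewrite (@rsum_widen (N %/ d) N) ?leq_div // => [|m hm].
    by apply: eq_rsum => m hm; rewrite mulnC -leq_divRL ?ifT //; lia.
  by rewrite ifF // mulnC -leq_divRL //; lia.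
rewrite H rsum_exchange (H (fun m d => F d m)).
by apply: eq_rsum => m _; apply: eq_rsum => d _; rewrite mulnC.
Qed.

(** * Casts from integers, floor quotients and elementary logarithm bounds *)

Lemma Rabs_le_inv x a : Rabs x <= a -> - a <= x <= a.
Proof. by move=> h; have := Rle_abs x; have := Rle_abs (- x); rewrite Rabs_Ropp; lra. Qed.

Lemma INR_ge1 n : (0 < n)%N -> 1 <= INR n.
Proof. by move=> n0; apply: (le_INR 1); apply/leP. Qed.

Lemma leq_INR m n : (m <= n)%N -> INR m <= INR n.
Proof. by move=> /leP; apply: le_INR. Qed.

Lemma ltn_INR m n : (m < n)%N -> INR m < INR n.
Proof. by move=> /ltP; apply: lt_INR. Qed.

Lemma INR_muln m n : INR (m * n) = INR m * INR n.
Proof. exact: mult_INR. Qed.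

Lemma INR_addn m n : INR (m + n) = INR m + INR n.
Proof. exact: plus_INR. Qed.

Lemma INR_divn_le N d : (0 < d)%N -> INR (N %/ d) <= INR N / INR d.
Proof.
move=> d0; have d1 := INR_ge1 d0.
apply: (Rmult_le_reg_r (INR d)); first lra.
rewrite -INR_muln; have -> : INR N / INR d * INR d = INR N by field; lra.
by apply: leq_INR; apply: leq_trunc_div.
Qed.

Lemma INR_divn_gt N d : (0 < d)%N -> INR N / INR d < INR (N %/ d) + 1.
Proof.
move=> d0; have d1 := INR_ge1 d0.
apply: (Rmult_lt_reg_r (INR d)); first lra.
rewrite -S_INR -INR_muln; have -> : INR N / INR d * INR d = INR N by field; lra.
by apply: ltn_INR; apply: ltn_ceil.
Qed.

Notation lnn n := (ln (INR n)).

Lemma lnn1 : lnn 1 = 0.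
Proof. by rewrite /= ln_1. Qed.

Lemma ln_le_sub1 x : 0 < x -> ln x <= x - 1.
Proof.
move=> x0; have := exp_ineq1_le (ln x); rewrite exp_ln //; lra.
Qed.

Lemma ln_mono x y : 0 < x -> x <= y -> ln x <= ln y.
Proof. by move=> x0 [xy|->]; [left; apply: ln_increasing | right]. Qed.

(** [ln] takes the default value 0 outside the positive reals, which makes [lnn] nonnegative on all
    of [nat]. *)
Lemma lnn0 : lnn 0 = 0.
Proof.
by rewrite /= /ln; case: (Rlt_dec 0 0) => [h|//]; case: (Rlt_irrefl _ h).
Qed.

Lemma lnn_ge0 n : 0 <= lnn n.
Proof.
case: n => [|n]; first by rewrite lnn0; lra.
by rewrite -ln_1; apply: ln_mono; have := @INR_ge1 n.+1 isT; lra.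
Qed.

Lemma lnn_mono m n : (0 < m)%N -> (m <= n)%N -> lnn m <= lnn n.
Proof. by move=> m0 mn; apply: ln_mono; [have := INR_ge1 m0; lra | exact: leq_INR]. Qed.

Lemma lnn_muln m n : (0 < m)%N -> (0 < n)%N -> lnn (m * n) = lnn m + lnn n.
Proof.
move=> /INR_ge1 m0 /INR_ge1 n0; rewrite INR_muln ln_mult; lra.
Qed.

Lemma ln_div x y : 0 < x -> 0 < y -> ln (x / y) = ln x - ln y.
Proof.
move=> x0 y0; rewrite /Rdiv ln_mult ?ln_Rinv //; exact: Rinv_0_lt_compat.
Qed.

Lemma ln_sub_le x y : 0 < x -> 0 < y -> ln y - ln x <= (y - x) / x.
Proof.
move=> x0 y0; rewrite -ln_div //; apply: Rle_trans (ln_le_sub1 _) _.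
  exact: Rdiv_lt_0_compat.
by right; field; lra.
Qed.

Lemma lnnS_sub_le n : (0 < n)%N -> lnn n.+1 - lnn n <= / INR n.
Proof.
move=> /INR_ge1 n0; have := @ln_sub_le (INR n) (INR n.+1).
rewrite S_INR; have -> : (INR n + 1 - INR n) / INR n = / INR n by field; lra.
by apply; lra.
Qed.

Lemma lnnS_sub_ge n : (0 < n)%N -> / INR n.+1 <= lnn n.+1 - lnn n.
Proof.
move=> /INR_ge1 n0; have := @ln_sub_le (INR n.+1) (INR n).
rewrite S_INR; have -> : (INR n - (INR n + 1)) / (INR n + 1) = - / (INR n + 1) by field; lra.
by move=> h; have := h ltac:(lra) ltac:(lra); lra.
Qed.

Lemma ln_le_2sqrt x : 0 < x -> ln x <= 2 * sqrt x.
Proof.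
move=> x0; have s0 := sqrt_lt_R0 _ x0.
have E : ln x = 2 * ln (sqrt x).
  by rewrite -{1}(sqrt_sqrt x) ?ln_mult //; lra.
have := ln_le_sub1 s0; lra.
Qed.

(** * Prime factors of p n, and induction along prime factors *)

Lemma primes_mul_dvd p n : prime p -> (0 < n)%N -> (p %| n)%N -> primes (p * n) = primes n.
Proof.
move=> pp n0 pn; apply: (eq_primes _ _).1 => q.
rewrite primesM ?(prime_gt0 pp) // primes_prime // inE.
by case: eqP => [->|//]; rewrite mem_primes pp n0 pn.
Qed.

Lemma primes_mul_ndvd p n : prime p -> (0 < n)%N -> ~~ (p %| n)%N ->
  perm_eq (primes (p * n)) (p :: primes n).
Proof.
move=> pp n0 pn; apply: uniq_perm; rewrite ?primes_uniq //=.
  by rewrite primes_uniq mem_primes (negbTE pn) !andbF.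
by move=> q; rewrite primesM ?(prime_gt0 pp) // primes_prime // !inE.
Qed.

Lemma logn_mul_prime q p n : prime p -> (0 < n)%N -> logn q (p * n) = ((q == p) + logn q n)%N.
Proof.
move=> pp n0; rewrite lognM ?(prime_gt0 pp) //; case: (boolP (prime q)) => qp.
  by rewrite logn_prime.
by rewrite /logn (negbTE qp) (_ : (q == p) = false) //; apply: contraNF qp => /eqP->.
Qed.

Lemma prime_nat_ind (P : nat -> Prop) : P 1%N ->
  (forall p n, prime p -> (0 < n)%N -> P n -> P (p * n)%N) ->
  forall n, (0 < n)%N -> P n.
Proof.
move=> P1 PM n; have [m] := ubnP n; elim: m n => // m IH n nm n0.
case: (ltnP 1 n) => n1; last by have -> : n = 1%N by lia.
have pp := pdiv_prime n1; have E := divnK (pdiv_dvd n).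
rewrite -E mulnC; have n'0 : (0 < n %/ pdiv n)%N by rewrite divn_gt0 ?pdiv_gt0 // pdiv_leq.
apply: PM => //; apply: IH => //; have := prime_gt1 pp; nia.
Qed.

(** * The von Mangoldt and Chebyshev functions *)

(** A single prime divisor characterises the prime powers p^k with k >= 1, and [pdiv n] is then
    p. *)
Definition Lam (n : nat) : R := if size (primes n) == 1%N then lnn (pdiv n) else 0.

Lemma Lam_pfactor p k : prime p -> Lam (p ^ k.+1) = lnn p.
Proof. by move=> pp; rewrite /Lam primesX // primes_prime // pdiv_pfactor. Qed.

Lemma LamP n : Lam n = 0 \/ exists p k, prime p /\ n = (p ^ k.+1)%N /\ Lam n = lnn p.
Proof.
rewrite /Lam; case: eqP => s1; last by left.
have n1 : (1 < n)%N by case: n s1 => [|[|]].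
have pp := pdiv_prime n1; right; exists (pdiv n), (logn (pdiv n) n).-1; split=> //; split=> //.
have l0 : (0 < logn (pdiv n) n)%N by rewrite logn_gt0 mem_primes pp pdiv_dvd; lia.
have n0 : (0 < n)%N by lia.
have pin : pdiv n \in primes n by rewrite mem_primes pp pdiv_dvd n0.
rewrite prednK // {1}(prod_prime_decomp n0) prime_decompE.
case: (primes n) s1 pin => [|q [|//]] // _; rewrite inE => /eqP <-.
by rewrite /= big_seq1.
Qed.

Lemma Lam_ge0 n : 0 <= Lam n.
Proof. by rewrite /Lam; case: ifP => _; [exact: lnn_ge0 | lra]. Qed.

Lemma Lam_le n : Lam n <= lnn n.
Proof.
case: (LamP n) => [->|[p [k [pp [-> ->]]]]]; first exact: lnn_ge0.
by apply: lnn_mono; rewrite ?prime_gt0 // expnS leq_pmulr // expn_gt0 prime_gt0.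
Qed.

Lemma Lam1 : Lam 1 = 0.
Proof. by []. Qed.

(** Passing from n to p n creates exactly one new prime power divisor, the power [a] of p with
    exponent v_p(n) + 1, and it contributes log p. *)
Lemma rsum_Lam_dvd n : (0 < n)%N ->
  \rsum_(d <= n) (if (d %| n)%N then Lam d else 0) = lnn n.
Proof.
move: n; apply: prime_nat_ind => [|p n pp n0 IH].
  by rewrite rsumS rsum0 /= Lam1 ln_1; lra.
rewrite lnn_muln ?(prime_gt0 pp) // -IH.
have p1 := prime_gt1 pp; set a := (p ^ (logn p n).+1)%N.
have aP : (0 < a <= p * n)%N.
  rewrite /a expn_gt0 (prime_gt0 pp) /= expnS leq_pmul2l ?(prime_gt0 pp) //.
  by apply: dvdn_leq => //; apply: pfactor_dvdnn.
rewrite -(@rsum_widen n (p * n)); first last.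
- by move=> d hd; case: ifP => // /dvdn_leq; lia.
- nia.
rewrite Rplus_comm -(rsum_single (fun=> lnn p) aP) -rsumD.
apply: eq_rsum => d hd; case: eqP => [->|da].
  rewrite /a Lam_pfactor // !pfactor_dvdn // ?muln_gt0 ?n0 ?(prime_gt0 pp) //.
  by rewrite logn_mul_prime // eqxx add1n !ltnn leqnn /=; lra.
rewrite Rplus_0_r; case: (LamP d) => [->|[q [k [qp [dE ->]]]]]; first by do 2!case: ifP.
rewrite dE !pfactor_dvdn // ?muln_gt0 ?n0 ?(prime_gt0 pp) // logn_mul_prime //.
case: eqP => [qpE|_] //; rewrite add1n ltnS leq_eqVlt.
by case: eqP => // kE; case: da; rewrite dE /a -qpE -kE.
Qed.

Definition psi (N : nat) : R := \rsum_(n <= N) Lam n.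

Lemma psi0 : psi 0 = 0.
Proof. exact: rsum0. Qed.

Lemma psiS n : psi n.+1 = psi n + Lam n.+1.
Proof. exact: rsumS. Qed.

Lemma psi_mono m n : (m <= n)%N -> psi m <= psi n.
Proof.
elim: n => [|n IH]; first by case: m => // _; lra.
rewrite leq_eqVlt => /orP[/eqP->|mn]; first lra.
by rewrite psiS; have := IH mn; have := Lam_ge0 n.+1; lra.
Qed.

Lemma psi_ge0 n : 0 <= psi n.
Proof. by rewrite -psi0; apply: psi_mono. Qed.

(** * Stirling, Chebyshev and Mertens bounds, from log N! *)

Definition lfact N := \rsum_(n <= N) lnn n.

Lemma rsum_Lam_floor N : \rsum_(n <= N) (Lam n * INR (N %/ n)) = lfact N.
Proof.
transitivity (\rsum_(n <= N) \rsum_(d <= n) (if (d %| n)%N then Lam d else 0)).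
  rewrite (rsum_divisors N (fun d _ => Lam d)).
  by apply: eq_rsum => d _; rewrite rsum_const Rmult_comm.
by apply: eq_rsum => n hn; apply: rsum_Lam_dvd; lia.
Qed.

Lemma rsum_psi_floor N : \rsum_(n <= N) psi (N %/ n) = lfact N.
Proof.
rewrite (rsum_hyperbola N (fun _ m => Lam m)) -rsum_Lam_floor.
by apply: eq_rsum => m _; rewrite rsum_const Rmult_comm.
Qed.

Lemma lfactS n : lfact n.+1 = lfact n + lnn n.+1.
Proof. exact: rsumS. Qed.

Lemma lfact_ge N : INR N * lnn N - INR N <= lfact N.
Proof.
elim: N => [|N IH]; first by rewrite /lfact rsum0 /=; lra.
case: (posnP N) => [->|N0]; first by rewrite lfactS /lfact rsum0 /= ln_1; lra.
have n1 := INR_ge1 N0; have h := lnnS_sub_le N0.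
rewrite lfactS; have : INR N * (lnn N.+1 - lnn N) <= 1.
  apply: Rle_trans (Rmult_le_compat_l _ _ _ _ h) _; first lra.
  by right; field; lra.
rewrite [INR N.+1 in X in X -> _]S_INR S_INR; lra.
Qed.

Lemma lfact_le N : (0 < N)%N -> lfact N <= INR N * lnn N - INR N + lnn N + 1.
Proof.
case: N => // N _; elim: N => [|N IH].
  by rewrite lfactS /lfact rsum0 /= ln_1; lra.
have n1 := @INR_ge1 N.+1 isT; have h := @lnnS_sub_ge N.+1 isT.
rewrite lfactS; have : 1 <= INR N.+2 * (lnn N.+2 - lnn N.+1).
  apply: Rle_trans (Rmult_le_compat_l _ _ _ _ h); last by apply: pos_INR.
  by rewrite Rinv_r; [lra|rewrite S_INR; lra].
rewrite (S_INR N.+1); lra.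
Qed.

Lemma lfact_diff_le N : (1 < N)%N -> lfact N - 2 * lfact (N %/ 2) <= 5 * INR N.
Proof.
move=> N1; set M := (N %/ 2)%N.
have M0 : (0 < M)%N by rewrite /M; lia.
have h1 := @lfact_le N ltac:(lia); have h2 := lfact_ge M.
have m1 := INR_ge1 M0.
have a1 : INR N <= 2 * INR M + 1.
  by rewrite -[2]/(INR 2) -[1]/(INR 1) -INR_muln -INR_addn; apply: leq_INR; rewrite /M; lia.
have a2 : 2 * INR M <= INR N.
  by rewrite -[2]/(INR 2) -INR_muln; apply: leq_INR; rewrite /M; lia.
have a3 : lnn N <= lnn M + 2.
  have := @ln_sub_le (INR M) (INR N) ltac:(lra) ltac:(lra).
  have : (INR N - INR M) / INR M <= 2; last lra.
  by apply: (Rmult_le_reg_r (INR M)); [lra | field_simplify; lra].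
have a4 := @ln_le_sub1 (INR N) ltac:(lra).
have := lnn_ge0 M; have := lnn_ge0 N.
nra.
Qed.

(** On the right, Lambda(n) has coefficient floor(N/n) - 2 floor(N/(2n)), which is never negative
    and is at least 1 for N/2 < n <= N. *)
Lemma psi_halving N : psi N - psi (N %/ 2) <= lfact N - 2 * lfact (N %/ 2).
Proof.
set M := (N %/ 2)%N; have MN : (M <= N)%N by rewrite leq_div.
rewrite -[lfact N]rsum_Lam_floor -[lfact M]rsum_Lam_floor.
rewrite -(@rsum_widen M N (fun n => Lam n * INR (M %/ n))) //; last first.
  by move=> i hi; rewrite divn_small ?Rmult_0_r //; lia.
have -> : psi M = \rsum_(n <= N) (if (n <= M)%N then Lam n else 0).
  rewrite (@rsum_widen M N) // => [|i hi]; last by rewrite ifF //; lia.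
  by apply: eq_rsum => i hi; rewrite ifT //; lia.
rewrite -rsumZ -!rsumB; apply: ler_rsum => n hn; have L0 := Lam_ge0 n.
have E : (M %/ n = N %/ n %/ 2)%N by rewrite /M divnAC.
have e1 : 2 * INR (M %/ n) <= INR (N %/ n).
  by rewrite -[2]/(INR 2) -INR_muln E; apply: leq_INR; lia.
case: leqP => nM; first nra.
rewrite (divn_small nM) /= !Rmult_0_r.
have : 1 <= INR (N %/ n) by apply: INR_ge1; rewrite divn_gt0; lia.
nra.
Qed.

(** Repeated halving costs 5 N (1 + 1/2 + 1/4 + ...) = 10 N. *)
Lemma psi_le N : psi N <= 10 * INR N.
Proof.
have [m] := ubnP N; elim: m N => // m IH N Nm.
case: (ltnP 1 N) => N1; last first.
  by case: N N1 {Nm} => [|[|]] //= _; rewrite ?psiS psi0 ?Lam1; lra.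
have := psi_halving N; have := lfact_diff_le N1.
have := IH (N %/ 2)%N ltac:(lia).
have : 2 * INR (N %/ 2) <= INR N.
  by rewrite -[2]/(INR 2) -INR_muln; apply: leq_INR; lia.
lra.
Qed.

(** Compare N times the sum with log N! = sum Lambda(n) floor(N/n): removing the floors costs at
    most psi(N) <= 10 N. *)
Lemma mertens N : (0 < N)%N -> Rabs (\rsum_(n <= N) (Lam n / INR n) - lnn N) <= 10.
Proof.
move=> N0; have n1 := INR_ge1 N0; set s := \rsum_(n <= N) _.
have h1 : lfact N <= INR N * s.
  rewrite /s -rsumZ -rsum_Lam_floor; apply: ler_rsum => n hn.
  have := @INR_divn_le N n ltac:(lia); have := Lam_ge0 n.
  rewrite /Rdiv; nra.
have h2 : INR N * s <= lfact N + psi N.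
  rewrite /s -rsumZ -rsum_Lam_floor -rsumD; apply: ler_rsum => n hn.
  have := @INR_divn_gt N n ltac:(lia); have := Lam_ge0 n.
  rewrite /Rdiv; nra.
have h3 := lfact_ge N; have h4 := lfact_le N0; have h5 := psi_le N.
have h6 := @ln_le_sub1 (INR N) ltac:(lra).
apply: Rabs_le; split; apply: (Rmult_le_reg_l (INR N)); nra.
Qed.

(** * Harmonic numbers *)

Definition harm M := \rsum_(k <= M) / INR k.

Lemma harmS n : harm n.+1 = harm n + / INR n.+1.
Proof. exact: rsumS. Qed.

Lemma harm_le M : (0 < M)%N -> harm M <= 1 + lnn M.
Proof.
case: M => // M _; elim: M => [|M IH].
  by rewrite harmS /harm rsum0 /= ln_1; lra.
by rewrite harmS; have := @lnnS_sub_ge M.+1 isT; lra.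
Qed.

(** Euler's constant g is the supremum of the increasing sequence [u]; it lies below the decreasing
    sequence [a], and a_M - u_M = log(1 + 1/M) <= 1/M. *)
Lemma harm_asymp : exists g, forall M, (0 < M)%N -> Rabs (harm M - lnn M - g) <= / INR M.
Proof.
pose u M := harm M - lnn M.+1; pose a M := harm M - lnn M.
have uS n : u n <= u n.+1.
  by rewrite /u harmS; have := @lnnS_sub_le n.+1 isT; lra.
have aS n : (0 < n)%N -> a n.+1 <= a n.
  by move=> n0; rewrite /a harmS; have := @lnnS_sub_ge n n0; lra.
have umono m n : (m <= n)%N -> u m <= u n.
  elim: n => [|n IH]; first by case: m => // _; lra.
  rewrite leq_eqVlt => /orP[/eqP->|mn]; first lra.
  by have := IH mn; have := uS n; lra.
have amono m n : (0 < m)%N -> (m <= n)%N -> a n <= a m.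
  move=> m0; elim: n => [|n IH]; first by lia.
  rewrite leq_eqVlt => /orP[/eqP->|mn]; first lra.
  by have := IH mn; have := aS n ltac:(lia); lra.
have ua n : (0 < n)%N -> u n <= a n.
  by move=> n0; rewrite /u /a; have := @lnn_mono n n.+1 n0 ltac:(lia); lra.
have ub m n : (0 < m)%N -> u n <= a m.
  move=> m0; case: (leqP n m) => nm.
    by have := umono _ _ nm; have := ua _ m0; lra.
  by have := ua n ltac:(lia); have := amono m n m0 ltac:(lia); lra.
have [|| g [g1 g2]] := completeness (fun x => exists n, x = u n).
- by exists (a 1%N) => x [n ->]; apply: ub.
- by exists (u 0%N), 0%N.
exists g => M M0.
have h1 : u M <= g by apply: g1; exists M.
have h2 : g <= a M by apply: g2 => x [n ->]; apply: ub.
have := lnnS_sub_le M0; move: h1 h2; rewrite /u /a => h1 h2 h3.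
by apply: Rabs_le; lra.
Qed.

(** * The Moebius function *)

Definition mu (n : nat) : R :=
  \big[Rmult/1]_(p <- primes n) (if logn p n == 1%N then -1 else 0).

Lemma mu1 : mu 1 = 1.
Proof. by rewrite /mu big_nil. Qed.

Lemma mu_abs n : Rabs (mu n) <= 1.
Proof.
rewrite /mu; apply: (big_ind (fun x => Rabs x <= 1)).
- by rewrite Rabs_R1; lra.
- move=> x y hx hy; rewrite Rabs_mult; have := Rabs_pos x; have := Rabs_pos y; nra.
- by move=> p _; case: ifP => _; rewrite ?Rabs_Ropp ?Rabs_R1 ?Rabs_R0; lra.
Qed.

Lemma mu_mul_prime p n : prime p -> (0 < n)%N ->
  mu (p * n) = if (p %| n)%N then 0 else - mu n.
Proof.
move=> pp n0; rewrite /mu; case: ifP => pn.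
  rewrite primes_mul_dvd // (bigD1_seq p) ?primes_uniq ?mem_primes ?pp ?n0 //=.
  rewrite logn_mul_prime // eqxx ifF ?Rmult_0_l //.
  have l0 : (0 < logn p n)%N by rewrite logn_gt0 mem_primes pp n0 pn.
  by case: (logn p n) l0.
rewrite (perm_big _ (primes_mul_ndvd pp n0 (negbT pn))) big_cons.
rewrite logn_mul_prime // eqxx lognE pn !andbF /= -Ropp_mult_distr_l Rmult_1_l.
congr (- _); apply: eq_big_seq => q; rewrite mem_primes => /andP[qp /andP[_ qn]].
by rewrite logn_mul_prime // (_ : (q == p) = false) //; apply: contraFF pn => /eqP<-.
Qed.

(* Pairs the divisor d prime to p with the divisor p d. *)
Lemma mu_pairing p n (F : nat -> R) : prime p -> (0 < n)%N -> (p %| n)%N ->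
  \rsum_(d <= n) (if (d %| n)%N then mu d * F d else 0) =
  \rsum_(d <= n) (if (d %| n)%N && ~~ (p %| d)%N then mu d * (F d - F (p * d)%N) else 0).
Proof.
move=> pp n0 pn.
pose G d := if (d %| n)%N then mu d * F d else 0.
transitivity (\rsum_(d <= n) (if (d %| n)%N && ~~ (p %| d)%N then mu d * F d else 0) +
              \rsum_(d <= n) (if (p %| d)%N then G d else 0)).
  by rewrite -rsumD; apply: eq_rsum => d hd; rewrite /G;
    case: (d %| n)%N; case: (p %| d)%N => /=; lra.
rewrite rsum_multiples ?prime_gt0 //.
have dvdE d : ~~ (p %| d)%N -> (p * d %| n)%N = (d %| n)%N.
  move=> pd; rewrite Gauss_dvd ?pn // prime_coprime //.
transitivity (\rsum_(d <= n) (if (d %| n)%N && ~~ (p %| d)%N then mu d * F d else 0) +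
  \rsum_(d <= n) (if (d %| n)%N && ~~ (p %| d)%N then - mu d * F (p * d)%N else 0)).
  congr (_ + _); rewrite (@rsum_widen (n %/ p) n) ?leq_div //; last first.
    move=> d hd; case: ifP => // /andP[dn pd]; move: dn; rewrite -dvdE // => /dvdn_leq.
    by move=> /(_ n0) le; move: hd; rewrite ltn_divLR ?prime_gt0 // mulnC; lia.
  apply: eq_rsum => d hd; rewrite /G mu_mul_prime //; last by case/andP: hd.
  case: (boolP (p %| d)%N) => pd; rewrite ?andbF ?andbT; first by case: ifP; lra.
  by rewrite dvdE.
by rewrite -rsumD; apply: eq_rsum => d hd; case: ifP => _; lra.
Qed.

Lemma rsum_mu_dvd n : (0 < n)%N ->
  \rsum_(d <= n) (if (d %| n)%N then mu d else 0) = if n == 1%N then 1 else 0.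
Proof.
move=> n0; case: eqP => [->|n1]; first by rewrite rsumS rsum0 dvdnn mu1; lra.
have n2 : (1 < n)%N by lia.
have := mu_pairing (fun=> 1) (pdiv_prime n2) n0 (pdiv_dvd n).
rewrite [X in _ = X -> _](@eq_rsum _ _ (fun=> 0)); last first.
  by move=> d _; case: ifP => _; lra.
by rewrite rsum_const Rmult_0_r => E; rewrite -[RHS]E; apply: eq_rsum => d _; case: ifP => _; lra.
Qed.

(** For F = log the pairing leaves the constant difference - log p. With n = m p^a and p not
    dividing m, what remains is - log p times the sum of mu over the divisors of m, which vanishes
    unless m = 1, that is, unless n is a power of p. *)
Lemma rsum_mu_ln_dvd n : (0 < n)%N ->
  \rsum_(d <= n) (if (d %| n)%N then mu d * lnn d else 0) = - Lam n.
Proof.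
move=> n0; case: (leqP n 1) => n1.
  have -> : n = 1%N by lia.
  by rewrite rsumS rsum0 Lam1 /= ln_1; lra.
have pp := pdiv_prime n1; set p := pdiv n in pp *.
rewrite (mu_pairing (fun d => lnn d) pp n0 (pdiv_dvd n)).
have [m cpm nE] := pfactor_coprime pp n0; set a := logn p n in nE *.
have m0 : (0 < m)%N by move: n0; rewrite nE muln_gt0 => /andP[].
have a0 : (0 < a)%N by rewrite /a logn_gt0 mem_primes pp n0 pdiv_dvd.
transitivity (- lnn p * \rsum_(d <= n) (if (d %| m)%N then mu d else 0)).
  rewrite -rsumZ; apply: eq_rsum => d hd.
  have -> : (d %| n)%N && ~~ (p %| d)%N = (d %| m)%N.
    apply/andP/idP => [[dn pd]|dm].
      by move: dn; rewrite nE Gauss_dvdl // coprime_sym coprimeXl // prime_coprime.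
    split; first by rewrite nE dvdn_mulr.
    by rewrite -prime_coprime //; apply: coprime_dvdr dm cpm.
  by case: ifP => _; rewrite ?lnn_muln ?(prime_gt0 pp) //; [lra | lia | lra].
rewrite (@rsum_widen m n) ?rsum_mu_dvd //; last first.
- by move=> d hd; case: ifP => // /dvdn_leq; lia.
- by rewrite nE leq_pmulr // expn_gt0 prime_gt0.
case: eqP => m1.
  by rewrite nE m1 mul1n -(prednK a0) Lam_pfactor //; lra.
case: (LamP n) => [->|[q [k [qp [nq _]]]]]; first lra.
case: m1; have pq : p = q.
  have : (p %| q ^ k.+1)%N by rewrite -nq pdiv_dvd.
  by rewrite Euclid_dvdX // => /andP[]; rewrite dvdn_prime2 // => /eqP.
have : (m %| p ^ k.+1)%N by rewrite pq -nq nE dvdn_mulr.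
have : coprime m (p ^ k.+1) by rewrite coprime_sym coprimeXl.
by move=> /coprime_dvdr h1 /h1; rewrite /coprime gcdnn => /eqP.
Qed.

(** * Selberg's formula *)

Definition err (N : nat) : R := psi N - INR N.

Lemma err0 : err 0 = 0.
Proof. by rewrite /err psi0 /=; lra. Qed.

Lemma err_abs n : Rabs (err n) <= 10 * INR n.
Proof.
apply: Rabs_le; rewrite /err; have := psi_le n; have := psi_ge0 n; have := pos_INR n; lra.
Qed.

Lemma rsum_inv_sqrt_le N : \rsum_(d <= N) / sqrt (INR d) <= 2 * sqrt (INR N).
Proof.
elim: N => [|n IH]; first by rewrite rsum0 sqrt_0; lra.
rewrite rsumS; set x := sqrt (INR n.+1); set y := sqrt (INR n) in IH *.
have x0 : 0 < x by apply: sqrt_lt_R0; have := @INR_ge1 n.+1 isT; lra.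
have y0 : 0 <= y by apply: sqrt_pos.
have xx : x * x = INR n + 1 by rewrite -S_INR; apply: sqrt_sqrt; apply: pos_INR.
have yy : y * y = INR n by apply: sqrt_sqrt; apply: pos_INR.
have : / x <= 2 * x - 2 * y; last lra.
apply: (Rmult_le_reg_r x) => //; rewrite Rinv_l; last lra.
nra.
Qed.

Lemma ln_ge0 x : 1 <= x -> 0 <= ln x.
Proof. by move=> x1; rewrite -ln_1; apply: ln_mono; lra. Qed.

(** Here 18 = 2 + 16: log t <= 2 t^(1/2), and log t = 2 log t^(1/2) <= 4 t^(1/4). A bound of order
    t^(1/2) makes the sum over t = N/d of order N, without a logarithm. *)
Lemma ln_ln_le_sqrt t : 1 <= t -> ln t * (1 + ln t) <= 18 * sqrt t.
Proof.
move=> t1; have s1 : 1 <= sqrt t by rewrite -sqrt_1; apply: sqrt_le_1_alt.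
have h1 := @ln_le_2sqrt t ltac:(lra).
have h2 := @ln_le_2sqrt (sqrt t) ltac:(lra).
have E : ln t = 2 * ln (sqrt t).
  by rewrite -{1}(sqrt_sqrt t) ?ln_mult //; lra.
have q0 := sqrt_pos (sqrt t); have qq := @sqrt_sqrt (sqrt t) ltac:(lra).
have := ln_ge0 t1; nra.
Qed.

Lemma divn_ge1 N d : (0 < d <= N)%N -> 1 <= INR N / INR d.
Proof.
move=> /andP[d0 dN]; have d1 := INR_ge1 d0; have := leq_INR dN => h.
by apply: (Rmult_le_reg_r (INR d)); [lra | field_simplify; lra].
Qed.

Lemma rsum_ln_ln_le N : (0 < N)%N ->
  \rsum_(d <= N) (ln (INR N / INR d) * (1 + ln (INR N / INR d))) <= 36 * INR N.
Proof.
move=> N0; have n1 := INR_ge1 N0.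
apply: Rle_trans (_ : \rsum_(d <= N) (18 * sqrt (INR N) * / sqrt (INR d)) <= _).
  apply: ler_rsum => d hd; have d1 := @INR_ge1 d ltac:(lia).
  apply: Rle_trans (ln_ln_le_sqrt (divn_ge1 hd)) _.
  rewrite sqrt_div_alt; last lra.
  by rewrite /Rdiv; lra.
rewrite rsumZ; have := rsum_inv_sqrt_le N; have := sqrt_pos (INR N).
have := @sqrt_sqrt (INR N) ltac:(lra); nra.
Qed.

(** The coefficient of f(n) on the left is the sum over d dividing n of mu(d) (log N - log d), which
    is Lambda(n), plus log N when n = 1. *)
Lemma tatuzawa_iseki N (f : nat -> R) : (0 < N)%N ->
  \rsum_(d <= N) (mu d * ln (INR N / INR d) * \rsum_(m <= N %/ d) f (d * m)%N) =
  f 1%N * lnn N + \rsum_(k <= N) (Lam k * f k).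
Proof.
move=> N0; have n1 := INR_ge1 N0.
transitivity (\rsum_(d <= N) \rsum_(m <= N %/ d) (mu d * ln (INR N / INR d) * f (d * m)%N)).
  by apply: eq_rsum => d _; rewrite rsumZ.
rewrite -(rsum_divisors N (fun d n => mu d * ln (INR N / INR d) * f n)).
have N1 : (0 < 1 <= N)%N by lia.
rewrite -(rsum_single (fun k => f k * lnn N) N1) -rsumD; apply: eq_rsum => n /andP[n0 _].
transitivity (f n * (lnn N * (\rsum_(d <= n) (if (d %| n)%N then mu d else 0))
    - \rsum_(d <= n) (if (d %| n)%N then mu d * lnn d else 0))).
  rewrite -rsumZ -rsumB -rsumZ; apply: eq_rsum => d /andP[d0 _].
  case: ifP => _; last lra.
  by rewrite ln_div; [lra | lra | have := INR_ge1 d0; lra].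
by rewrite rsum_mu_dvd // rsum_mu_ln_dvd //; case: eqP => _; lra.
Qed.

(* With c = 1 + gamma the terms of order N/d cancel between log (N/d)! and (N/d) H_(N/d). *)
Lemma selberg_inner : exists c C, 0 < C /\ forall N d, (0 < d <= N)%N ->
  Rabs (\rsum_(m <= N %/ d) (psi (N %/ (d * m)) - INR N / INR (d * m) + c))
  <= C * (1 + ln (INR N / INR d)).
Proof.
have [g hg] := harm_asymp; exists (1 + g), (3 + Rabs g).
split=> [|N d hd]; first by have := Rabs_pos g; lra.
have /andP[d0 dN] := hd; have d1 := INR_ge1 d0.
set M := (N %/ d)%N; set y := INR N / INR d.
have M0 : (0 < M)%N by rewrite /M divn_gt0.
have m1 := INR_ge1 M0; have yM := INR_divn_le N d0; have yM1 := INR_divn_gt N d0.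
rewrite -/M -/y in yM yM1.
have -> : \rsum_(m <= M) (psi (N %/ (d * m)) - INR N / INR (d * m) + (1 + g)) =
    lfact M - y * harm M + INR M * (1 + g).
  rewrite rsumD rsum_const rsumB; congr (_ - _ + _).
    by rewrite -rsum_psi_floor; apply: eq_rsum => m _; rewrite divnMA.
  rewrite /harm -rsumZ; apply: eq_rsum => m /andP[m0 _]; have := INR_ge1 m0 => m1'.
  by rewrite INR_muln /y; field; lra.
have h1 := lfact_ge M; have h2 := lfact_le M0; have h3 := hg M M0.
have h4 : lnn M <= ln y by apply: ln_mono; lra.
have h5 := lnn_ge0 M.
set e := harm M - lnn M - g in h3.
have hE : harm M = lnn M + g + e by rewrite /e; lra.
have ye : Rabs (y * e) <= 2.
  rewrite Rabs_mult (Rabs_pos_eq y); last lra.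
  apply: Rle_trans (_ : (INR M + 1) * / INR M <= _).
    by apply: Rmult_le_compat => //; try lra; apply: Rabs_pos.
  by apply: (Rmult_le_reg_r (INR M)); [lra | field_simplify; lra].
have a1 : Rabs ((INR M - y) * lnn M) <= lnn M.
  rewrite Rabs_mult (Rabs_pos_eq (lnn M)) //.
  by have : Rabs (INR M - y) <= 1; [apply: Rabs_le; lra | nra].
have a2 : Rabs ((INR M - y) * g) <= Rabs g.
  rewrite Rabs_mult; have g0 := Rabs_pos g.
  by have : Rabs (INR M - y) <= 1; [apply: Rabs_le; lra | nra].
have -> : lfact M - y * harm M + INR M * (1 + g) =
  (lfact M - (INR M * lnn M - INR M)) + (INR M - y) * lnn M + (INR M - y) * g - y * e.
  by rewrite hE; ring.
have [b1 b2] := Rabs_le_inv ye; have [b3 b4] := Rabs_le_inv a1; have [b5 b6] := Rabs_le_inv a2.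
have g0 := Rabs_pos g.
apply: Rle_trans (_ : 2 * lnn M + 3 + Rabs g <= _); last nra.
by apply: Rabs_le; lra.
Qed.

(** The Tatuzawa-Iseki identity is applied to f(k) = psi(N/k) - N/k + c. By [selberg_inner] its left
    side is a sum of terms O(log(N/d) (1 + log(N/d))), hence O(N). Replacing f by [err] on the right
    costs c log N plus a bounded multiple of psi(N). *)
Lemma selberg_err : exists C, 0 < C /\ forall N, (0 < N)%N ->
  Rabs (err N * lnn N + \rsum_(k <= N) (Lam k * err (N %/ k))) <= C * INR N.
Proof.
have [c [C [C0 hC]]] := selberg_inner.
exists (36 * C + 11 * (Rabs c + 1)); split=> [|N N0]; first by have := Rabs_pos c; lra.
have n1 := INR_ge1 N0.
pose f k := psi (N %/ k) - INR N / INR k + c.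
have H := tatuzawa_iseki f N0.
have h1 : Rabs (f 1%N * lnn N + \rsum_(k <= N) (Lam k * f k)) <= 36 * C * INR N.
  rewrite -H; apply: Rle_trans (rsum_abs _ _) _.
  apply: Rle_trans
    (_ : C * (\rsum_(d <= N) (ln (INR N / INR d) * (1 + ln (INR N / INR d)))) <= _); last first.
    by have := rsum_ln_ln_le N0; nra.
  rewrite -rsumZ; apply: ler_rsum => d hd.
  have l0 := ln_ge0 (divn_ge1 hd).
  rewrite !Rabs_mult (Rabs_pos_eq (ln _)) //.
  have := hC N d hd; have := mu_abs d; rewrite -/(f _).
  set s := Rabs (\big[_/_]_(_ <= _ < _) _) => b1 b2.
  have s0 : 0 <= s by apply: Rabs_pos.
  have := Rabs_pos (mu d).
  set l := ln _ in l0 b2 * => b3.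
  have : Rabs (mu d) * l <= l by nra.
  have : l * s <= l * (C * (1 + l)) by apply: Rmult_le_compat_l.
  nra.
have -> : err N * lnn N + \rsum_(k <= N) (Lam k * err (N %/ k)) =
  (f 1%N * lnn N + \rsum_(k <= N) (Lam k * f k))
   - (c * lnn N + \rsum_(k <= N) (Lam k * (c - (INR N / INR k - INR (N %/ k))))).
  rewrite (@eq_rsum _ (fun k => Lam k * err (N %/ k))
    (fun k => Lam k * f k - Lam k * (c - (INR N / INR k - INR (N %/ k))))).
    by rewrite rsumB /f divn1 /err /=; field.
  by move=> k _; rewrite /f /err; lra.
have h2 : Rabs (\rsum_(k <= N) (Lam k * (c - (INR N / INR k - INR (N %/ k))))) <=
    (Rabs c + 1) * psi N.
  apply: Rle_trans (rsum_abs _ _) _; rewrite /psi -rsumZ; apply: ler_rsum => k /andP[k0 _].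
  rewrite Rabs_mult (Rabs_pos_eq (Lam k)); last exact: Lam_ge0.
  have := INR_divn_le N k0; have := INR_divn_gt N k0; have := Lam_ge0 k => b1 b2 b3.
  have : Rabs (c - (INR N / INR k - INR (N %/ k))) <= Rabs c + 1.
    apply: Rle_trans (Rabs_triang _ _) _; rewrite Rabs_Ropp.
    by rewrite (Rabs_pos_eq (_ - _)); lra.
  nra.
have h3 : Rabs (c * lnn N) <= Rabs c * INR N.
  rewrite Rabs_mult (Rabs_pos_eq (lnn N)); last exact: lnn_ge0.
  by have := @ln_le_sub1 (INR N) ltac:(lra); have := Rabs_pos c; nra.
have b1 := psi_le N; have c0 := Rabs_pos c.
apply: Rle_trans (Rabs_triang _ _) _; rewrite Rabs_Ropp.
have := Rabs_triang (c * lnn N) (\rsum_(k <= N) (Lam k * (c - (INR N / INR k - INR (N %/ k))))).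
nra.
Qed.

Lemma lfact_le_mul_ln N : lfact N <= INR N * lnn N.
Proof.
case: (posnP N) => [->|N0]; first by rewrite /lfact rsum0 /=; lra.
have n1 := INR_ge1 N0; have := lfact_le N0; have := @ln_le_sub1 (INR N) ltac:(lra); lra.
Qed.

Lemma rsum_Lam_ln N : (0 < N)%N ->
  Rabs (\rsum_(n <= N) (Lam n * lnn n) - psi N * lnn N) <= 10 * INR N.
Proof.
move=> N0; have n1 := INR_ge1 N0.
rewrite (rsum_abel N Lam (fun n => lnn n)) -/(psi N).
have h n : (0 < n)%N -> 0 <= psi n * (lnn n.+1 - lnn n) <= 10.
  move=> n0; have i1 := INR_ge1 n0; have := psi_le n; have := psi_ge0 n => p0 p1.
  have l1 := lnnS_sub_le n0; have l0 := @lnn_mono n n.+1 n0 ltac:(lia).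
  split; first by apply: Rmult_le_pos; lra.
  apply: Rle_trans (_ : 10 * INR n * / INR n <= _); first by apply: Rmult_le_compat; lra.
  by right; field; lra.
have h0 := h N N0.
have : 0 <= \rsum_(n <= N) (psi n * (lnn n.+1 - lnn n)) <= INR N * 10.
  split; first by apply: rsum_ge0 => i /andP[i0 _]; case: (h i i0).
  by rewrite -rsum_const; apply: ler_rsum => i /andP[i0 _]; case: (h i i0).
have -> : \rsum_(i <= N) ((\rsum_(j <= i) Lam j) * (lnn i - lnn i.+1)) =
  -1 * \rsum_(n <= N) (psi n * (lnn n.+1 - lnn n)).
  by rewrite -rsumZ; apply: eq_rsum => i _; rewrite -/(psi i); lra.
by move=> h1; apply: Rabs_le; lra.
Qed.

(* Selberg's weight Lambda log + Lambda * Lambda, whose mean value is 2 log. *)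
Definition Lam2 n : R :=
  Lam n * lnn n + \rsum_(d <= n) (if (d %| n)%N then Lam d * Lam (n %/ d) else 0).

Lemma rsum_Lam2 N (g : nat -> R) : \rsum_(n <= N) (Lam2 n * g n) =
  \rsum_(n <= N) (Lam n * lnn n * g n) +
  \rsum_(d <= N) (Lam d * \rsum_(m <= N %/ d) (Lam m * g (d * m)%N)).
Proof.
have -> : \rsum_(d <= N) (Lam d * \rsum_(m <= N %/ d) (Lam m * g (d * m)%N)) =
  \rsum_(d <= N) (\rsum_(m <= N %/ d) (Lam d * Lam ((d * m) %/ d) * g (d * m)%N)).
  apply: eq_rsum => d hd; rewrite -rsumZ; apply: eq_rsum => m _.
  by rewrite mulKn; [lra | lia].
rewrite -(rsum_divisors N (fun d n => Lam d * Lam (n %/ d) * g n)) -rsumD.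
apply: eq_rsum => n _; rewrite /Lam2 Rmult_plus_distr_r; congr (_ + _).
by rewrite Rmult_comm -rsumZ; apply: eq_rsum => d _; case: ifP => _; lra.
Qed.

(** Since psi(m) = err(m) + m, the sum of [Lam2] is the left side of Selberg's formula plus N log N
    + log N! + O(N), and log N! = N log N + O(N). *)
Lemma rsum_Lam2_asymp : exists C, 0 < C /\ forall N,
  Rabs (\rsum_(n <= N) (Lam2 n - 2 * lnn n)) <= C * INR N.
Proof.
have [C [C0 hC]] := selberg_err; exists (C + 11); split=> [|N]; first lra.
case: (posnP N) => [->|N0]; first by rewrite rsum0 Rabs_R0 /=; lra.
have n1 := INR_ge1 N0.
rewrite rsumB rsumZ -/(lfact N).
rewrite (@eq_rsum _ Lam2 (fun n => Lam2 n * 1)); last by move=> i _; lra.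
rewrite (rsum_Lam2 N (fun=> 1)).
rewrite (@eq_rsum _ (fun n => Lam n * lnn n * 1) (fun n => Lam n * lnn n)); last by move=> i _; lra.
have -> : \rsum_(d <= N) (Lam d * \rsum_(m <= N %/ d) (Lam m * 1)) =
  \rsum_(d <= N) (Lam d * err (N %/ d)) + lfact N.
  rewrite -rsum_Lam_floor -rsumD; apply: eq_rsum => d _.
  rewrite (@eq_rsum _ (fun m => Lam m * 1) Lam); last by move=> i _; lra.
  by rewrite -/(psi _) /err; lra.
have := lfact_ge N; have := lfact_le_mul_ln N => h1 h2.
have /Rabs_le_inv := rsum_Lam_ln N0; have /Rabs_le_inv := hC N N0.
have -> : err N * lnn N = psi N * lnn N - INR N * lnn N by rewrite /err; ring.
by move=> h3 h4; apply: Rabs_le; lra.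
Qed.

(** Selberg's formula is multiplied by log N and used again at N/k for each term err(N/k) log N,
    after splitting log N into log k + log(N/k). The log k parts and the double sum add up to the
    weight [Lam2]. *)
Lemma err_iter_Lam2 : exists C, 0 < C /\ forall N, (0 < N)%N ->
  Rabs (err N) * lnn N ^ 2 <=
  \rsum_(n <= N) (Lam2 n * Rabs (err (N %/ n))) + C * INR N * (1 + lnn N).
Proof.
have [C [C0 hC]] := selberg_err; exists (2 * C + 100); split=> [|N N0]; first lra.
have n1 := INR_ge1 N0; have l0 := lnn_ge0 N.
have step k : (0 < k <= N)%N -> Rabs (err (N %/ k) * lnn N) <=
    Rabs (err (N %/ k)) * lnn k + (C * INR (N %/ k) + 10)
    + \rsum_(j <= N %/ k) (Lam j * Rabs (err (N %/ (k * j)))).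
  move=> /andP[k0 kN]; set m := (N %/ k)%N; have k1 := INR_ge1 k0.
  have m0 : (0 < m)%N by rewrite divn_gt0.
  have m1 := INR_ge1 m0; have b1 := INR_divn_le N k0; have b2 := INR_divn_gt N k0.
  rewrite -/m in b1 b2.
  set s := \rsum_(j <= m) _.
  set t := \rsum_(j <= m) (Lam j * err (m %/ j)).
  have ts : Rabs t <= s.
    apply: Rle_trans (rsum_abs _ _) _; right; apply: eq_rsum => j _.
    by rewrite Rabs_mult (Rabs_pos_eq (Lam j)) ?divnMA //; apply: Lam_ge0.
  (* The discrepancy caused by m being the floor of N/k; it is at most 1/m, so err(m) e stays
     bounded. *)
  pose e := lnn N - lnn k - lnn m.
  have e0 : 0 <= e <= / INR m.
    have -> : e = ln (INR N / INR k) - lnn m by rewrite ln_div /e; lra.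
    split; first by have := @ln_mono (INR m) (INR N / INR k) ltac:(lra) ltac:(lra); lra.
    apply: Rle_trans (ln_sub_le _ _) _; try lra.
    rewrite -[X in _ <= X]Rmult_1_l; apply: Rmult_le_compat_r; last lra.
    by left; apply: Rinv_0_lt_compat; lra.
  have ee : Rabs (err m * e) <= 10.
    rewrite Rabs_mult (Rabs_pos_eq e); last lra.
    apply: Rle_trans (_ : 10 * INR m * / INR m <= _).
      by apply: Rmult_le_compat; try lra; [apply: Rabs_pos | apply: err_abs].
    by right; field; lra.
  have -> : err m * lnn N = err m * lnn k + ((err m * lnn m + t) - t + err m * e).
    by rewrite /e; ring.
  have /Rabs_le_inv c1 := hC m m0; have /Rabs_le_inv c2 := ts; have /Rabs_le_inv c3 := ee.
  rewrite -/t in c1.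
  apply: Rle_trans (Rabs_triang _ _) _.
  rewrite Rabs_mult (Rabs_pos_eq (lnn k)); last exact: lnn_ge0.
  have : Rabs (err m * lnn m + t - t + err m * e) <= C * INR m + 10 + s by apply: Rabs_le; lra.
  lra.
rewrite rsum_Lam2.
have main : Rabs (\rsum_(k <= N) (Lam k * err (N %/ k))) * lnn N <=
   \rsum_(k <= N) (Lam k * lnn k * Rabs (err (N %/ k))) + (C * lfact N + 10 * psi N) +
   \rsum_(d <= N) (Lam d * \rsum_(m <= N %/ d) (Lam m * Rabs (err (N %/ (d * m))))).
  have -> : C * lfact N + 10 * psi N = \rsum_(k <= N) (Lam k * (C * INR (N %/ k) + 10)).
    rewrite -rsum_Lam_floor /psi -!rsumZ -rsumD; apply: eq_rsum => k _; lra.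
  rewrite -!rsumD -[X in _ * X <= _](Rabs_pos_eq _ l0) -Rabs_mult Rmult_comm -rsumZ.
  apply: Rle_trans (rsum_abs _ _) _; apply: ler_rsum => k hk.
  have L0 := Lam_ge0 k.
  have -> : lnn N * (Lam k * err (N %/ k)) = Lam k * (err (N %/ k) * lnn N) by ring.
  rewrite Rabs_mult (Rabs_pos_eq (Lam k)) //.
  apply: Rle_trans (Rmult_le_compat_l _ _ _ L0 (step k hk)) _; lra.
have h1 := hC N N0; have h2 := lfact_le_mul_ln N; have h3 := psi_le N.
have -> : Rabs (err N) * lnn N ^ 2 = Rabs (err N * lnn N) * lnn N.
  by rewrite Rabs_mult (Rabs_pos_eq _ l0) /=; ring.
set t := \rsum_(k <= N) (Lam k * err (N %/ k)) in h1 main.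
have h4 : Rabs (err N * lnn N) <= C * INR N + Rabs t.
  have := Rabs_triang (err N * lnn N + t) (- t); rewrite Rabs_Ropp.
  by rewrite (_ : err N * lnn N + t + - t = err N * lnn N); [lra | ring].
apply: Rle_trans (Rmult_le_compat_r _ _ _ l0 h4) _.
nra.
Qed.

(** [Lam2] is replaced by its mean value 2 log through partial summation, which requires control of
    the variation of n -> |err(N/n)|. *)
Lemma err_iter : exists C, 0 < C /\ forall N, (0 < N)%N ->
  Rabs (err N) * lnn N ^ 2 <=
  2 * (\rsum_(n <= N) (lnn n * Rabs (err (N %/ n)))) + C * INR N * (1 + lnn N).
Proof.
have [C1 [C10 h1]] := err_iter_Lam2; have [C2 [C20 h2]] := rsum_Lam2_asymp.
exists (C1 + 2 * C2); split=> [|N N0]; first lra.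
have n1 := INR_ge1 N0; have l0 := lnn_ge0 N.
apply: Rle_trans (h1 N N0) _.
pose g n := Rabs (err (N %/ n)).
have -> : \rsum_(n <= N) (Lam2 n * Rabs (err (N %/ n))) =
  2 * (\rsum_(n <= N) (lnn n * g n)) + \rsum_(n <= N) ((Lam2 n - 2 * lnn n) * g n).
  by rewrite -rsumZ -rsumD; apply: eq_rsum => n _; rewrite /g; lra.
rewrite -[X in _ <= 2 * X + _]/(\rsum_(n <= N) (lnn n * g n)).
(* [v] decreases in n and its decrements dominate the variation of |err(N/n)|. Summing n (v(n) -
   v(n+1)) back gives the sum of v, which is O(N (1 + log N)). *)
pose v n := psi (N %/ n) + INR (N %/ n).
have gN : g N.+1 = 0 by rewrite /g divn_small // err0 Rabs_R0.
have vN : v N.+1 = 0 by rewrite /v divn_small // psi0 /=; lra.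
have E := rsum_abel N (fun=> 1) v.
have : \rsum_(n <= N) ((Lam2 n - 2 * lnn n) * g n) <= C2 * (\rsum_(n <= N) v n).
  rewrite (@eq_rsum N v (fun n => 1 * v n)); last by move=> i _; lra.
  rewrite E rsum_abel gN vN !Rmult_0_r !Rplus_0_r -rsumZ; apply: ler_rsum => n /andP[n0 nN].
  rewrite rsum_const Rmult_1_r.
  apply: Rle_trans (Rle_abs _) _; rewrite Rabs_mult -Rmult_assoc.
  apply: Rmult_le_compat; try exact: Rabs_pos; first exact: h2.
  have le : (N %/ n.+1 <= N %/ n)%N by apply: leq_div2l.
  have p1 := psi_mono le; have p2 := leq_INR le.
  rewrite /g; apply: Rle_trans (Rabs_triang_inv2 _ _) _.
  by rewrite /v /err; apply: Rabs_le; lra.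
have : \rsum_(n <= N) v n <= 2 * INR N * (1 + lnn N).
  rewrite rsumD rsum_psi_floor; have := lfact_le_mul_ln N.
  have : \rsum_(i <= N) INR (N %/ i) <= INR N * harm N.
    by rewrite /harm -rsumZ; apply: ler_rsum => i /andP[i0 _]; apply: INR_divn_le.
  have := harm_le N0; nra.
by move=> hV hX; have := Rmult_le_compat_l C2 _ _ (Rlt_le _ _ C20) hV; lra.
Qed.

(** * The prime number theorem *)

Lemma nat_above r : exists n, (0 < n)%N /\ r < INR n.
Proof.
have [n hn] := INR_unbounded r; exists n.+1; split=> //; rewrite S_INR; lra.
Qed.

Lemma lnn_unbounded r : exists X, (0 < X)%N /\ forall n, (X <= n)%N -> r <= lnn n.
Proof.
have [X [X0 hX]] := nat_above (exp r); exists X; split=> // n Xn.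
rewrite -(ln_exp r); apply: ln_mono; first exact: exp_pos.
have := leq_INR Xn; lra.
Qed.

Lemma lnn_sublinear e : 0 < e -> exists X, (0 < X)%N /\ forall n, (X <= n)%N -> lnn n <= e * INR n.
Proof.
move=> e0; have [X [X0 hX]] := nat_above ((2 / e) ^ 2); exists X; split=> // n Xn.
have n1 := @INR_ge1 n ltac:(lia); have hn := leq_INR Xn.
apply: Rle_trans (ln_le_2sqrt _) _; first lra.
have s : 2 / e <= sqrt (INR n).
  rewrite -(sqrt_pow2 (2 / e)); last by apply: Rle_mult_inv_pos; lra.
  by apply: sqrt_le_1_alt; lra.
have s0 := sqrt_pos (INR n); rewrite -{2}(sqrt_sqrt (INR n)); last lra.
have : 2 <= e * sqrt (INR n); last nra.
have -> : 2 = e * (2 / e) by field; lra.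
by apply: Rmult_le_compat_l; lra.
Qed.

Lemma ler_rsum_diff m n (F G : nat -> R) : (m <= n)%N ->
  (forall i, (m < i <= n)%N -> F i <= G i) ->
  \rsum_(i <= n) F i - \rsum_(i <= m) F i <= \rsum_(i <= n) G i - \rsum_(i <= m) G i.
Proof.
elim: n => [|n IH]; first by case: m => // _ _; lra.
rewrite leq_eqVlt => /orP[/eqP->|mn] h; first lra.
have := IH mn (fun i hi => h i ltac:(lia)); have := h n.+1 ltac:(lia).
rewrite !(rsumS n); lra.
Qed.

(** The weight 1/(z (z + 1)) = 1/z - 1/(z + 1) is the one produced by partial summation: the psi
    part becomes Mertens' sum and the other part a harmonic sum, both equal to log x + O(1). *)
Lemma rsum_err_bounded : exists A, 0 < A /\ forall x,
  Rabs (\rsum_(z <= x) (err z / (INR z * INR z.+1))) <= A.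
Proof.
have [g hg] := harm_asymp; exists (30 + Rabs g); split=> [|x]; first by have := Rabs_pos g; lra.
case: (posnP x) => [->|x0]; first by rewrite rsum0 Rabs_R0; have := Rabs_pos g; lra.
have x1 := INR_ge1 x0.
have -> : \rsum_(z <= x) (err z / (INR z * INR z.+1)) =
  \rsum_(n <= x) (psi n * (/ INR n - / INR n.+1)) - \rsum_(n <= x) / INR n.+1.
  rewrite -rsumB; apply: eq_rsum => z /andP[z0 _]; have z1 := INR_ge1 z0.
  by rewrite /err S_INR; field; lra.
have := rsum_abel x Lam (fun n => / INR n); rewrite -/(psi x) => E.
have -> : \rsum_(n <= x) / INR n.+1 = harm x.+1 - 1.
  elim: x {x0 x1 E} => [|x IH]; first by rewrite rsum0 harmS /harm rsum0 /=; lra.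
  by rewrite rsumS IH (harmS _.+1); lra.
have := mertens x0 => /Rabs_le_inv.
rewrite (@eq_rsum _ (fun n => Lam n / INR n) (fun n => Lam n * / INR n)) // E.
have -> : \rsum_(i <= x) ((\rsum_(j <= i) Lam j) * (/ INR i - / INR i.+1)) =
   \rsum_(n <= x) (psi n * (/ INR n - / INR n.+1)) by [].
have h1 : 0 <= psi x * / INR x.+1 <= 10.
  have p0 := psi_ge0 x; have p1 := psi_le x; rewrite S_INR.
  split; first by apply: Rle_mult_inv_pos; lra.
  by apply: (Rmult_le_reg_r (INR x + 1)); [lra | rewrite Rmult_assoc Rinv_l; lra].
have := hg x x0 => /Rabs_le_inv; rewrite harmS.
have := Rinv_le_contravar 1 (INR x) ltac:(lra) ltac:(lra).
have := Rinv_le_contravar 1 (INR x.+1) ltac:(lra) ltac:(rewrite S_INR; lra).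
have := Rinv_0_lt_compat (INR x.+1) ltac:(rewrite S_INR; lra).
rewrite Rinv_1 => a1 a2 a3 a4 a5.
have [g1 g2] := Rabs_le_inv (Rle_refl (Rabs g)).
apply: Rabs_le; lra.
Qed.

Lemma harm_diff_ge y x : (0 < y <= x)%N -> ln (INR x / INR y) - 2 <= harm x - harm y.
Proof.
move=> /andP[y0 yx]; have [g hg] := harm_asymp.
have y1 := INR_ge1 y0; have x1 := leq_INR yx.
rewrite ln_div; try lra.
have := hg y y0 => /Rabs_le_inv; have := hg x ltac:(lia) => /Rabs_le_inv.
have := Rinv_le_contravar 1 (INR x) ltac:(lra) ltac:(lra).
have := Rinv_le_contravar 1 (INR y) ltac:(lra) ltac:(lra).
rewrite Rinv_1; lra.
Qed.

Lemma harm_diff_le y x : (0 < y <= x)%N -> harm x - harm y <= ln (INR x / INR y).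
Proof.
move=> /andP[y0]; have y1 := INR_ge1 y0; elim: x => [|x IH]; first lia.
rewrite leq_eqVlt => /orP[/eqP<-|yx].
  by have -> : INR y / INR y = 1; [field; lra | rewrite ln_1; lra].
have x1 := @leq_INR y x yx; have x2 := @leq_INR x x.+1 ltac:(lia).
have := IH yx; rewrite !ln_div ?harmS; try lra.
by have := @lnnS_sub_ge x ltac:(lia); lra.
Qed.

(* Otherwise err would keep a constant sign on [y, k y], as its steps are too small to jump over
   the forbidden band, and the bounded sum of err z / (z (z + 1)) would gain log k / D. *)
Lemma err_small_point D : (0 < D)%N -> exists k X, (0 < k)%N /\
  forall y, (X <= y)%N -> exists z, (y <= z <= k * y)%N /\ Rabs (err z) <= INR z / INR D.
Proof.
move=> D0; have D1 := INR_ge1 D0.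
have [A [A0 hA]] := rsum_err_bounded.
(* Then (log k - 4)/D, a lower bound for the gain over [y, k y], exceeds 2 A, the largest difference
   between two of the bounded sums. *)
have [k [k0 hk]] := nat_above (exp (2 * A * INR D + 10)).
have [X1 [X10 hX1]] := @lnn_sublinear (/ (2 * INR D)) ltac:(apply: Rinv_0_lt_compat; lra).
exists k, (X1 + D)%N; split=> // y hy.
apply: Classical_Prop.NNPP => no.
have far z : (y <= z <= k * y)%N -> INR z / INR D < Rabs (err z).
  move=> hz; case: (Rle_lt_dec (Rabs (err z)) (INR z / INR D)) => // h.
  by case: no; exists z.
have y0 : (0 < y)%N by lia.
have yk : (y <= k * y)%N by nia.
have lnk : 2 * A * INR D + 10 < ln (INR k).
  by rewrite -(ln_exp (2 * A * INR D + 10)); apply: ln_increasing => //; apply: exp_pos.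
have zD z : (y <= z)%N -> 1 <= INR z / INR D.
  by move=> yz; apply: divn_ge1; lia.
have lnS z : (y <= z)%N -> lnn z.+1 <= INR z / INR D.
  move=> yz; apply: Rle_trans (hX1 z.+1 ltac:(lia)) _.
  have z1 := @INR_ge1 z ltac:(lia).
  rewrite S_INR; apply: (Rmult_le_reg_r (2 * INR D)); first lra.
  by field_simplify; lra.
have errS z : err z.+1 = err z + Lam z.+1 - 1 by rewrite /err psiS S_INR; lra.
have divS z : INR z.+1 / INR D = INR z / INR D + / INR D by rewrite S_INR; field; lra.
have Dinv : 0 < / INR D by apply: Rinv_0_lt_compat; lra.
(* Steps of [err] are asymmetric: a decrease is at most 1, handled by z >= D, whereas an increase
   can approach log(z + 1), handled by z >= X1. *)
have sgn : (forall z, (y <= z <= k * y)%N -> INR z / INR D <= err z) \/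
           (forall z, (y <= z <= k * y)%N -> INR z / INR D <= - err z).
  case: (Rle_lt_dec 0 (err y)) => ey.
    left => z /andP[]; elim: z => [|z IH]; first lia.
    rewrite leq_eqVlt => /orP[/eqP<- h|yz zk].
      by have := far y ltac:(lia); rewrite Rabs_pos_eq; lra.
    have := IH yz ltac:(lia); have := far z.+1 ltac:(lia); have := zD z yz.
    rewrite divS errS; have := Lam_ge0 z.+1.
    by rewrite /Rabs; case: Rcase_abs; lra.
  right => z /andP[]; elim: z => [|z IH]; first lia.
  rewrite leq_eqVlt => /orP[/eqP<- h|yz zk].
    by have := far y ltac:(lia); rewrite Rabs_left; lra.
  have := IH yz ltac:(lia); have := far z.+1 ltac:(lia); have := lnS z yz.
  rewrite divS errS; have := Lam_le z.+1.
  by rewrite /Rabs; case: Rcase_abs; lra.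
have low : / INR D * (ln (INR k) - 4) <=
   / INR D * (harm (k * y).+1 - harm y.+1).
  apply: Rmult_le_compat_l; first lra.
  have ky : (0 < y.+1 <= (k * y).+1)%N by lia.
  have := harm_diff_ge ky; have : ln (INR k) - 2 <= ln (INR (k * y).+1 / INR y.+1); last lra.
  have y1 := INR_ge1 y0; have k1 := INR_ge1 k0.
  rewrite ln_div ?S_INR ?INR_muln; try nra.
  have h1 : ln (INR k * INR y) <= ln (INR k * INR y + 1) by apply: ln_mono; nra.
  have h2 : ln (INR y + 1) <= ln (INR y) + 1.
    have := @ln_sub_le (INR y) (INR y + 1) ltac:(lra) ltac:(lra).
    have : (INR y + 1 - INR y) / INR y <= 1; last lra.
    by apply: (Rmult_le_reg_r (INR y)); [lra | field_simplify; lra].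
  by rewrite ln_mult in h1; lra.
have harmE n : \rsum_(z <= n) (/ INR D * / INR z.+1) = / INR D * (harm n.+1 - 1).
  rewrite rsumZ; congr (_ * _).
  elim: n => [|n IH]; first by rewrite rsum0 harmS /harm rsum0 /=; lra.
  by rewrite rsumS IH (harmS _.+1); lra.
have fin : / INR D * (ln (INR k) - 4) <= 2 * A.
  apply: Rle_trans low _; have := hA (k * y)%N; have := hA y => /Rabs_le_inv a1 /Rabs_le_inv a2.
  have pt s z : (y < z <= k * y)%N -> INR z / INR D <= s * err z ->
      / INR D * / INR z.+1 <= s * (err z / (INR z * INR z.+1)).
    move=> hz h; have z1 := @INR_ge1 z ltac:(lia).
    have -> : / INR D * / INR z.+1 = INR z / INR D * / (INR z * INR z.+1).
      by rewrite S_INR; field; lra.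
    rewrite /Rdiv -Rmult_assoc; apply: Rmult_le_compat_r => //.
    by left; apply: Rinv_0_lt_compat; rewrite S_INR; nra.
  case: sgn => sg.
    have := ler_rsum_diff yk (fun z hz => pt 1 z hz ltac:(have := sg z ltac:(lia); lra)).
    by rewrite !harmE !rsumZ; lra.
  have := ler_rsum_diff yk (fun z hz => pt (-1) z hz ltac:(have := sg z ltac:(lia); lra)).
  by rewrite !harmE !rsumZ; lra.
have := Rmult_le_compat_l (INR D) _ _ ltac:(lra) fin.
rewrite -Rmult_assoc Rinv_r; lra.
Qed.

Lemma psi_short_interval : exists C, 0 < C /\ forall z w, (0 < z <= w)%N -> (w <= 2 * z)%N ->
  (psi w - psi z) * lnn z <= 2 * (INR w - INR z) * lnn z + C * INR z.
Proof.
have [C [C0 hC]] := selberg_err; exists (3 * (C + 1) + 4).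
split=> [|z w /andP[z0 zw] w2]; first lra.
have V N : (0 < N)%N ->
    Rabs (psi N * lnn N + \rsum_(k <= N) (Lam k * psi (N %/ k)) - 2 * INR N * lnn N) <=
    (C + 1) * INR N.
  move=> N0; have n1 := INR_ge1 N0; have /Rabs_le_inv h := hC N N0.
  have -> : \rsum_(k <= N) (Lam k * psi (N %/ k)) =
    \rsum_(k <= N) (Lam k * err (N %/ k)) + lfact N.
    by rewrite -rsum_Lam_floor -rsumD; apply: eq_rsum => k _; rewrite /err; lra.
  have := lfact_ge N; have := lfact_le_mul_ln N.
  have E : err N * lnn N = psi N * lnn N - INR N * lnn N by rewrite /err; ring.
  by rewrite E in h => h1 h2; apply: Rabs_le; lra.
have z1 := INR_ge1 z0; have zw1 := leq_INR zw.
have w1 : INR w <= 2 * INR z by rewrite -[2]/(INR 2) -INR_muln; apply: leq_INR.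
have /Rabs_le_inv hz := V z z0; have /Rabs_le_inv hw := V w ltac:(lia).
have mono : \rsum_(k <= z) (Lam k * psi (z %/ k)) <= \rsum_(k <= w) (Lam k * psi (w %/ k)).
  rewrite -(@rsum_widen z w (fun k => Lam k * psi (z %/ k))) //; last first.
    by move=> i hi; rewrite divn_small ?psi0 ?Rmult_0_r //; lia.
  apply: ler_rsum => k hk; apply: Rmult_le_compat_l; first exact: Lam_ge0.
  by apply: psi_mono; apply: leq_div2r.
have lz := lnn_ge0 z; have lzw := lnn_mono z0 zw; have pw := psi_ge0 w.
have d := @ln_sub_le (INR z) (INR w) ltac:(lra) ltac:(lra).
have dd : (INR w - INR z) / INR z <= 1.
  by apply: (Rmult_le_reg_r (INR z)); [lra | field_simplify; lra].
have : 2 * INR w * (lnn w - lnn z) <= 4 * INR z by nra.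
nra.
Qed.

(** The 3 collects z/D from err(z), z/D from the excess 2 (w - z) - (w - z), and z/D from the
    remainder C z/log z. In the other direction [psi] is monotone, so only w - z is lost. *)
Lemma err_short_interval D : (0 < D)%N -> exists X, (0 < X)%N /\
  forall z w, (X <= z)%N -> Rabs (err z) <= INR z / INR D ->
  (z <= w <= z + z %/ D)%N -> Rabs (err w) <= 3 * INR w / INR D.
Proof.
move=> D0; have D1 := INR_ge1 D0; have [C [C0 hC]] := psi_short_interval.
have [X [X0 hX]] := lnn_unbounded (C * INR D).
exists X; split=> // z w Xz /Rabs_le_inv ez /andP[zw wz].
have z0 : (0 < z)%N by lia.
have z1 := INR_ge1 z0; have zw1 := leq_INR zw.
have dz : INR w - INR z <= INR z / INR D.
  have := INR_divn_le z D0; have := leq_INR wz; rewrite INR_addn; lra.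
have zDz : (z %/ D <= z)%N by apply: leq_div.
have h := hC z w ltac:(lia) ltac:(lia); have lz := hX z Xz.
have l0 : 0 < lnn z by nra.
have h2 : psi w - psi z <= 2 * (INR w - INR z) + INR z / INR D.
  apply: (Rmult_le_reg_r (lnn z)) => //; apply: Rle_trans h _.
  rewrite Rmult_plus_distr_r; apply: Rplus_le_compat_l.
  apply: Rle_trans (_ : INR z / INR D * (C * INR D) <= _); first by right; field; lra.
  by apply: Rmult_le_compat_l => //; apply: Rle_mult_inv_pos; lra.
have p := psi_mono zw.
have wD : INR z / INR D <= INR w / INR D.
  by apply: Rmult_le_compat_r => //; left; apply: Rinv_0_lt_compat; lra.
rewrite /err in ez *; apply: Rabs_le; rewrite /Rdiv Rmult_assoc -/(Rdiv _ _); lra.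
Qed.

Lemma err_good_interval D : (0 < D)%N -> exists k X, (0 < k)%N /\ (0 < X)%N /\
  forall y, (X <= y)%N -> exists z, (y <= z <= k * y)%N /\
  forall w, (z <= w <= z + z %/ D)%N -> Rabs (err w) <= 3 * INR w / INR D.
Proof.
move=> D0; have [k [X1 [k0 h1]]] := err_small_point D0; have [X2 [X20 h2]] := err_short_interval D0.
exists k, (X1 + X2)%N; split=> //; split=> [|y hy]; first lia.
have [z [hz ez]] := h1 y ltac:(lia); exists z; split=> // w hw.
by apply: (h2 z) => //; lia.
Qed.

(** * Contraction of the bound |R(N)| <= a N *)

Definition err_le (a : R) := exists X, forall N, (X <= N)%N -> Rabs (err N) <= a * INR N.

(* On the block (B, 6kB] the trivial bound on the sum is a N / n; the n for which N / n falls in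
   the good interval [z, z + z/D] save half of it, and their reciprocals sum to at least
   1 / (2 (D + 1)). *)
Lemma err_block D k X a B N :
  (0 < D)%N -> (0 < k)%N -> (0 < X)%N ->
  (forall y, (X <= y)%N -> exists z, (y <= z <= k * y)%N /\
    forall w, (z <= w <= z + z %/ D)%N -> Rabs (err w) <= 3 * INR w / INR D) ->
  6 / INR D <= a ->
  (forall m, (X <= m)%N -> Rabs (err m) <= a * INR m) ->
  (2 * D.+1 <= B)%N -> (6 * k * B * X <= N)%N ->
  \rsum_(n <= 6 * k * B) Rabs (err (N %/ n)) - \rsum_(n <= B) Rabs (err (N %/ n)) <=
  a * (1 - / (4 * INR D.+1 * INR (6 * k))) * INR N * (harm (6 * k * B) - harm B).
Proof.
move=> D0 k0 X0 good aD ea BD KBX.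
have D1 := INR_ge1 D0; have B0 : (0 < B)%N by lia.
have B1 := INR_ge1 B0; have K1 := @INR_ge1 (6 * k) ltac:(lia).
have a0 : 0 < a by have := @Rdiv_lt_0_compat 6 (INR D) ltac:(lra) ltac:(lra); lra.
set K := (6 * k)%N in KBX K1 *.
have KB0 : (0 < K * B)%N by rewrite muln_gt0; lia.
set u := (N %/ (K * B))%N.
have uX : (X <= u)%N by rewrite leq_divRL // mulnC.
have [z [/andP[yz zy] gz]] := good u.+1 ltac:(lia).
have z0 : (0 < z)%N by lia.
have Nu : (u * (K * B) <= N)%N by apply: leq_trunc_div.
have Nu1 : (N < u.+1 * (K * B))%N by apply: ltn_ceil.
set z' := (z + z %/ D)%N in gz.
have z'z : (z' <= 2 * z)%N by rewrite /z'; have := leq_div z D; lia.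
(* Source of the 6 in K = 6 k: u + 1 <= 2 u and z' + 1 <= 3 z. Thus 3 z B <= N, which places the
   saving range (n1, n2] inside the block. *)
have zu : (3 * z <= K * u)%N.
  by rewrite /K; have : (k * u.+1 <= k * (2 * u))%N; [apply: leq_mul; lia | lia].
have zB : (3 * z * B <= N)%N.
  by apply: leq_trans Nu; rewrite mulnA [(u * K)%N]mulnC leq_mul2r zu orbT.
set n1 := (N %/ z'.+1)%N; set n2 := (N %/ z)%N.
have Bn1 : (B <= n1)%N.
  rewrite leq_divRL //; apply: leq_trans zB; rewrite [(B * _)%N]mulnC leq_mul2r; lia.
have n12 : (n1 <= n2)%N by apply: leq_div2l => //; apply: leqW; apply: leq_addr.
have n2K : (n2 <= K * B)%N.
  rewrite -ltnS ltn_divLR //; apply: leq_trans Nu1 _.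
  by rewrite mulnC leq_mul.
have N0 : (0 < N)%N by apply: leq_trans KBX; rewrite !muln_gt0 /K; lia.
have N1 := INR_ge1 N0; have z1 := INR_ge1 z0.
have bnd n : (0 < n <= K * B)%N -> Rabs (err (N %/ n)) <= a * INR N * / INR n.
  move=> /andP[n0 nK]; apply: Rle_trans (ea _ _) _.
    by apply: leq_trans uX _; apply: leq_div2l.
  by rewrite Rmult_assoc; apply: Rmult_le_compat_l; [lra | apply: INR_divn_le].
have s1 := @ler_rsum_diff B n1
  (fun n => Rabs (err (N %/ n))) (fun n => a * INR N * / INR n) Bn1
  (fun n hn => bnd n ltac:(lia)).
have s3 := @ler_rsum_diff n2 (K * B)
  (fun n => Rabs (err (N %/ n))) (fun n => a * INR N * / INR n) n2K
  (fun n hn => bnd n ltac:(lia)).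
have bnd2 n : (n1 < n <= n2)%N -> Rabs (err (N %/ n)) <= a / 2 * INR N * / INR n.
  move=> hn; have n0 : (0 < n)%N by lia.
  have zn : (z <= N %/ n)%N by rewrite leq_divRL // mulnC -leq_divRL //; lia.
  have nz : (N %/ n <= z')%N.
    by rewrite -ltnS ltn_divLR // mulnC -ltn_divLR //; lia.
  apply: Rle_trans (gz _ _) _; first lia.
  have -> : 3 * INR (N %/ n) / INR D = (6 / INR D) / 2 * INR (N %/ n) by field; lra.
  rewrite Rmult_assoc; apply: Rmult_le_compat; try lra.
  - by have := @Rdiv_lt_0_compat 6 (INR D); lra.
  - exact: pos_INR.
  - exact: INR_divn_le.
have s2 := ler_rsum_diff n12 bnd2.
rewrite !rsumZ -!/(harm _) in s1 s2 s3.
(* Each n <= n2 has 1/n >= z/N, and there are at least (N/z)(1 - D/(D + 1)) - 1 values of n. The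
   product is 1/(D + 1) - z/N, and B >= 2 (D + 1) makes z/N at most half of the first term. *)
have cnt : / (2 * INR D.+1) <= harm n2 - harm n1.
  have := @ler_rsum_diff n1 n2 (fun n => INR z / INR N) (fun n => / INR n) n12.
  rewrite !rsum_const -!/(harm _) => /(_ _) h.
  apply: Rle_trans (h _); last first.
    move=> n hn; have n0 := @INR_ge1 n ltac:(lia).
    have : INR z * INR n <= INR N.
      by rewrite -INR_muln; apply: leq_INR; rewrite mulnC -leq_divRL //; lia.
    move=> h'; apply: (Rmult_le_reg_r (INR n * INR N)); first nra.
    by field_simplify; lra.
  have c2 := INR_divn_gt N z0; have c1 := @INR_divn_le N z'.+1 isT.
  rewrite -/n1 -/n2 in c1 c2.
  have z'D : INR z + INR z / INR D <= INR z'.+1.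
    by rewrite S_INR /z' INR_addn; have := INR_divn_gt z D0; lra.
  have c3 : INR N / INR z'.+1 <= INR N / INR z * (INR D / INR D.+1).
    have -> : INR N / INR z * (INR D / INR D.+1) = INR N * / (INR z + INR z / INR D).
      by rewrite S_INR; field; nra.
    apply: Rmult_le_compat_l; first lra.
    apply: Rinv_le_contravar => //; have := @Rdiv_lt_0_compat (INR z) (INR D); lra.
  have zN : INR z / INR N <= / (2 * INR D.+1).
    have : 3 * INR z * INR B <= INR N.
      by have := leq_INR zB; rewrite !INR_muln /=; lra.
    have : 2 * INR D.+1 <= INR B by rewrite -[2]/(INR 2) -INR_muln; apply: leq_INR.
    move=> b1 b2; apply: (Rmult_le_reg_r (2 * INR D.+1 * INR N)); first by rewrite S_INR; nra.
    by rewrite S_INR in b1 *; field_simplify; nra.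
  have : (INR N / INR z - 1 - INR N / INR z * (INR D / INR D.+1)) * (INR z / INR N) <=
         INR n2 * (INR z / INR N) - INR n1 * (INR z / INR N).
    rewrite -Rmult_minus_distr_r; apply: Rmult_le_compat_r; last lra.
    by apply: Rle_mult_inv_pos; lra.
  have -> : (INR N / INR z - 1 - INR N / INR z * (INR D / INR D.+1)) * (INR z / INR N) =
    / INR D.+1 - INR z / INR N by rewrite S_INR; field; lra.
  have -> : / INR D.+1 = 2 * / (2 * INR D.+1) by rewrite S_INR; field; lra.
  lra.
(* A bound on the mass of the whole block converts the additive saving a N/(4 (D + 1)) into a factor
   1 - 1/(4 (D + 1) K). *)
have hK : harm (K * B) - harm B <= INR K.
  have BK : (0 < B <= K * B)%N by rewrite B0 leq_pmull // /K; lia.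
  have := harm_diff_le BK.
  have -> : INR (K * B) / INR B = INR K by rewrite INR_muln; field; lra.
  by have := @ln_le_sub1 (INR K) ltac:(lra); lra.
have eta : / (4 * INR D.+1 * INR K) * (harm (K * B) - harm B) <= / 2 * / (2 * INR D.+1).
  have -> : / 2 * / (2 * INR D.+1) = / (4 * INR D.+1 * INR K) * INR K.
    by rewrite S_INR; field; lra.
  by apply: Rmult_le_compat_l => //; left; apply: Rinv_0_lt_compat; rewrite S_INR; nra.
have aN : 0 < a * INR N by nra.
have := Rmult_le_compat_l (a * INR N) _ _ ltac:(lra) eta.
have := Rmult_le_compat_l (a / 2 * INR N) _ _ ltac:(lra) cnt.
lra.
Qed.

Lemma rsum_ln_div_le N : \rsum_(n <= N) (lnn n * / INR n) <= lnn N ^ 2 / 2 + harm N.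
Proof.
elim: N => [|N IH].
  by rewrite rsum0 /harm rsum0; have := lnn_ge0 0; nra.
case: (posnP N) => [->|N0].
  by rewrite rsumS rsum0 harmS /harm rsum0 /= ln_1; lra.
rewrite rsumS harmS; have n1 := INR_ge1 N0.
have h1 := lnnS_sub_le N0; have h2 := lnnS_sub_ge N0.
have h3 := Rinv_le_contravar 1 (INR N) ltac:(lra) ltac:(lra); rewrite Rinv_1 in h3.
have h4 := lnn_ge0 N; have h5 := Rinv_0_lt_compat (INR N.+1) ltac:(rewrite S_INR; lra).
have : / INR N.+1 * (lnn N.+1 + lnn N) <= (lnn N.+1 - lnn N) * (lnn N.+1 + lnn N).
  by apply: Rmult_le_compat_r; lra.
nra.
Qed.

(** Blocks of ratio K are glued by induction. Across a block log n varies by at most log K, so it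
    may be frozen at its largest value; this accounts for the extra [lnn K] on the right. The
    initial n <= B only have the trivial bound and contribute O(N). *)
Lemma rsum_err_ln_blocks D k X a N (B := (2 * D.+1)%N) (K := (6 * k)%N)
  (b := a * (1 - / (4 * INR D.+1 * INR K))) :
  (0 < D)%N -> (0 < k)%N -> (0 < X)%N ->
  (forall y, (X <= y)%N -> exists z, (y <= z <= k * y)%N /\
    forall w, (z <= w <= z + z %/ D)%N -> Rabs (err w) <= 3 * INR w / INR D) ->
  6 / INR D <= a ->
  (forall m, (X <= m)%N -> Rabs (err m) <= a * INR m) ->
  forall j, (B * K ^ j * X <= N)%N ->
  \rsum_(n <= B * K ^ j) (lnn n * Rabs (err (N %/ n))) <=
  10 * INR B * lnn B * INR N + b * INR N * (\rsum_(n <= B * K ^ j) ((lnn n + lnn K) * / INR n)).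
Proof.
move=> D0 k0 X0 good aD ea.
have K1 : 1 <= INR K by apply: INR_ge1; rewrite /K; lia.
have D1 := INR_ge1 D0.
have b0 : 0 <= b.
  rewrite /b; apply: Rmult_le_pos.
    by have := @Rdiv_lt_0_compat 6 (INR D); lra.
  have : / (4 * INR D.+1 * INR K) <= / 1; last by rewrite Rinv_1; lra.
  by apply: Rinv_le_contravar; rewrite ?S_INR; nra.
have N0 := pos_INR N; have lK := lnn_ge0 K.
elim=> [|j IH] hN.
  rewrite expn0 muln1.
  have s0 : 0 <= \rsum_(n <= B) ((lnn n + lnn K) * / INR n).
    apply: rsum_ge0 => n /andP[n0 _]; have := lnn_ge0 n; have := INR_ge1 n0 => n1 ln0.
    by apply: Rle_mult_inv_pos; lra.
  apply: Rle_trans (_ : \rsum_(n <= B) (lnn B * (10 * INR N)) <= _); last first.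
    by rewrite rsum_const; have := Rmult_le_pos _ _ (Rmult_le_pos _ _ b0 N0) s0; lra.
  apply: ler_rsum => n /andP[n0 nB]; apply: Rmult_le_compat.
  - exact: lnn_ge0.
  - exact: Rabs_pos.
  - exact: lnn_mono.
  - apply: Rle_trans (err_abs _) _; apply: Rmult_le_compat_l; first lra.
    by apply: leq_INR; apply: leq_div.
set B' := (B * K ^ j)%N.
have E : (B * K ^ j.+1 = K * B')%N by rewrite /B' expnS; lia.
rewrite E in hN *.
have B'B : (B <= B')%N by rewrite leq_pmulr // expn_gt0 /K; lia.
have B'0 : (0 < B')%N by lia.
have KB : (B' <= K * B')%N by rewrite leq_pmull // /K; lia.
have := IH (leq_trans (leq_mul KB (leqnn X)) hN); rewrite -/B' => {}IH.
have blk := err_block D0 k0 X0 good aD ea B'B hN; rewrite -/K -/b in blk.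
have t1 : \rsum_(n <= K * B') (lnn n * Rabs (err (N %/ n))) -
          \rsum_(n <= B') (lnn n * Rabs (err (N %/ n))) <=
   lnn (K * B') * (\rsum_(n <= K * B') Rabs (err (N %/ n)) - \rsum_(n <= B') Rabs (err (N %/ n))).
  rewrite Rmult_minus_distr_l -!rsumZ; apply: ler_rsum_diff => // n hn.
  by apply: Rmult_le_compat_r; [apply: Rabs_pos | apply: lnn_mono; lia].
have t2 : lnn (K * B') * (harm (K * B') - harm B') <=
   \rsum_(n <= K * B') ((lnn n + lnn K) * / INR n) - \rsum_(n <= B') ((lnn n + lnn K) * / INR n).
  rewrite Rmult_minus_distr_l /harm -!rsumZ; apply: ler_rsum_diff => // n hn.
  apply: Rmult_le_compat_r.
    by left; apply: Rinv_0_lt_compat; have := @INR_ge1 n ltac:(lia); lra.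
  rewrite lnn_muln //; last by rewrite /K; lia.
  by have := @lnn_mono B' n ltac:(lia) ltac:(lia); lra.
have t3 := Rmult_le_compat_l _ _ _ (lnn_ge0 (K * B')) blk.
have t4 := Rmult_le_compat_l (b * INR N) _ _ ltac:(nra) t2.
lra.
Qed.

(** D, k and hence eta are fixed by a0 alone; only the threshold on N depends on a. This uniformity
    lets the contraction be iterated geometrically. *)
Lemma err_contract a0 : 0 < a0 -> exists eta, 0 < eta < 1 /\
  forall a, a0 <= a -> err_le a -> err_le (a * (1 - eta)).
Proof.
move=> a00; have [D [D0 hD]] := nat_above (6 / a0).
have [k [X1 [k0 [X10 good]]]] := err_good_interval D0.
have D1 := INR_ge1 D0.
pose K := (6 * k)%N; have K1 : 1 <= INR K by apply: INR_ge1; rewrite /K; lia.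
pose eta := / (4 * INR D.+1 * INR K).
have eta0 : 0 < eta by apply: Rinv_0_lt_compat; rewrite S_INR; nra.
have eta1 : eta <= 1.
  rewrite -Rinv_1; apply: Rinv_le_contravar; rewrite ?S_INR; nra.
(* The other half of eta pays for the error terms of order N log N. *)
exists (eta / 2); split=> [|a aa0 [X2 ea]]; first lra.
have aD : 6 / INR D <= a.
  apply: Rle_trans aa0; apply: (Rmult_le_reg_r (INR D)); first lra.
  have -> : 6 / INR D * INR D = 6 / a0 * a0 by field; lra.
  by rewrite [a0 * _]Rmult_comm; apply: Rmult_le_compat_r; lra.
pose X := (X1 + X2)%N; have X0 : (0 < X)%N by rewrite /X; lia.
have blocks N := @rsum_err_ln_blocks D k X a N D0 k0 X0 (fun y hy => good y ltac:(lia)) aD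
  (fun m hm => ea m ltac:(lia)).
set B := (2 * D.+1)%N in blocks; rewrite -/K -/eta in blocks.
have [C [C0 hC]] := err_iter.
pose C1 := 10 * INR B * lnn B; pose C3 := 10 * lnn (K * X).
pose C5 := 2 * C1 + 2 * a * (1 + lnn K) + 2 * C3 + C.
have lK := lnn_ge0 K.
have C1p : 0 <= C1.
  by rewrite /C1; apply: Rmult_le_pos (lnn_ge0 _); have := pos_INR B; lra.
have C3p : 0 <= C3 by rewrite /C3; have := lnn_ge0 (K * X); lra.
have C5p : 0 < C5 by rewrite /C5; nra.
have bound N : (B * X <= N)%N ->
    Rabs (err N) * lnn N ^ 2 <= a * (1 - eta) * INR N * lnn N ^ 2 + C5 * INR N * (1 + lnn N).
  move=> hN; have BX0 : (0 < B * X)%N by rewrite muln_gt0 /B; lia.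
  have N0 : (0 < N)%N by lia.
  have N1 := INR_ge1 N0; have lN := lnn_ge0 N.
  (* j counts the blocks that fit: M = B K^j satisfies M X <= N < K X M. The remaining M < n <= N
     have reciprocals summing to at most log(K X), so the trivial bound suffices there. *)
  pose q := (N %/ (B * X))%N; have q0 : (0 < q)%N by rewrite divn_gt0.
  have K2 : (1 < K)%N by rewrite /K; lia.
  have /andP[j1 j2] := trunc_log_bounds K2 q0.
  set j := trunc_log K q in j1 j2.
  have lo : (B * K ^ j * X <= N)%N.
    by move: j1; rewrite leq_divRL //; lia.
  have hi : (N < K * X * (B * K ^ j))%N.
    by move: j2; rewrite ltn_divLR // expnS; lia.
  set M := (B * K ^ j)%N in lo hi.
  have M0 : (0 < M)%N by rewrite muln_gt0 expn_gt0 /B /K; lia.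
  have MN : (M <= N)%N by apply: leq_trans lo; rewrite leq_pmulr.
  have b1 := blocks N j lo; rewrite -/M -/C1 in b1.
  have tail : \rsum_(n <= N) (lnn n * Rabs (err (N %/ n))) -
      \rsum_(n <= M) (lnn n * Rabs (err (N %/ n))) <= C3 * INR N * lnn N.
    have pt n : (M < n <= N)%N -> lnn n * Rabs (err (N %/ n)) <= 10 * INR N * lnn N * / INR n.
      move=> hn; have n0 : (0 < n)%N by lia.
      have -> : 10 * INR N * lnn N * / INR n = lnn N * (10 * (INR N / INR n)).
        by rewrite /Rdiv; ring.
      apply: Rmult_le_compat; [exact: lnn_ge0 | exact: Rabs_pos | apply: lnn_mono; lia |].
      apply: Rle_trans (err_abs _) _; have := INR_divn_le N n0; lra.
    apply: Rle_trans (ler_rsum_diff MN pt) _; rewrite !rsumZ -!/(harm _).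
    rewrite -Rmult_minus_distr_l /C3.
    have : harm N - harm M <= lnn (K * X); last first.
      move=> h'; have : 0 <= 10 * INR N * lnn N by nra.
      by move=> h''; have := Rmult_le_compat_l _ _ _ h'' h'; lra.
    apply: Rle_trans (harm_diff_le _) _; first lia.
    have m1 := INR_ge1 M0.
    apply: ln_mono; first by apply: Rdiv_lt_0_compat; lra.
    have := ltn_INR hi; rewrite INR_muln => hi'.
    by apply: (Rmult_le_reg_r (INR M)); [lra | field_simplify; lra].
  have full : \rsum_(n <= M) ((lnn n + lnn K) * / INR n) <=
      lnn N ^ 2 / 2 + (1 + lnn K) * (1 + lnn N).
    apply: Rle_trans (_ : \rsum_(n <= N) ((lnn n + lnn K) * / INR n) <= _).
      have pt n : (M < n <= N)%N -> 0 <= (lnn n + lnn K) * / INR n.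
        move=> hn; apply: Rle_mult_inv_pos; first by have := lnn_ge0 n; lra.
        by have := @INR_ge1 n ltac:(lia); lra.
      by have := ler_rsum_diff MN pt; rewrite !rsum_const; lra.
    have -> : \rsum_(n <= N) ((lnn n + lnn K) * / INR n) =
      \rsum_(n <= N) (lnn n * / INR n) + lnn K * harm N.
      by rewrite /harm -rsumZ -rsumD; apply: eq_rsum => n _; lra.
    have := rsum_ln_div_le N; have := harm_le N0; nra.
  have h := hC N N0.
  have ab : 0 <= a * (1 - eta) * INR N by apply: Rmult_le_pos; [apply: Rmult_le_pos; lra | lra].
  have h2 := Rmult_le_compat_l _ _ _ ab full.
  have h3 : a * (1 - eta) * INR N * ((1 + lnn K) * (1 + lnn N)) <=
            a * INR N * ((1 + lnn K) * (1 + lnn N)).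
    apply: Rmult_le_compat_r; first nra.
    by apply: Rmult_le_compat_r; [lra | nra].
  have h4 : 0 <= C1 * INR N * lnn N by apply: Rmult_le_pos => //; apply: Rmult_le_pos; lra.
  have h5 : 0 <= C3 * INR N by apply: Rmult_le_pos; lra.
  rewrite /C5; lra.
have [X3 [X30 hX3]] := lnn_unbounded (1 + 4 * C5 / (a * eta)).
exists (B * X + X3)%N => N hN.
have hb := bound N ltac:(lia); have hl := hX3 N ltac:(lia).
have ae : 0 < a * eta by nra.
have l1 : 1 <= lnn N by have := @Rdiv_lt_0_compat (4 * C5) (a * eta); lra.
have l2 : 4 * C5 <= a * eta * lnn N.
  have -> : 4 * C5 = a * eta * (4 * C5 / (a * eta)) by field; split; nra.
  by apply: Rmult_le_compat_l; lra.
have N0 := pos_INR N.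
apply: (Rmult_le_reg_r (lnn N ^ 2)); first by apply: pow_lt; lra.
apply: Rle_trans hb _.
have : C5 * INR N * (1 + lnn N) <= a * eta / 2 * INR N * lnn N ^ 2; last lra.
apply: Rle_trans (_ : C5 * INR N * (2 * lnn N) <= _).
  by apply: Rmult_le_compat_l; nra.
have : 0 <= INR N * lnn N by nra.
nra.
Qed.

Theorem psi_asymp e : 0 < e -> exists X, forall N, (X <= N)%N -> Rabs (psi N - INR N) <= e * INR N.
Proof.
move=> e0; have [eta [eta01 con]] := err_contract e0.
(* The start a = 10 is Chebyshev's bound; the maximum is taken because the contraction is only
   available for a >= e. *)
have step j : err_le (Rmax e (10 * (1 - eta) ^ j)).
  elim: j => [|j [X IH]].
    exists 0%N => N _; apply: Rle_trans (err_abs N) _.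
    apply: Rmult_le_compat_r; first exact: pos_INR.
    by rewrite /= Rmult_1_r; apply: Rmax_r.
  have [Y hY] := con (Rmax e (10 * (1 - eta) ^ j)) (Rmax_l _ _) (ex_intro _ X IH).
  exists Y => N /hY h; apply: Rle_trans h _; apply: Rmult_le_compat_r; first exact: pos_INR.
  rewrite /Rmax /=; do 2!case: Rle_dec; nra.
have [j hj] := pow_lt_1_zero (1 - eta) ltac:(rewrite Rabs_pos_eq; lra) (e / 10) ltac:(lra).
have [X hX] := step j; exists X => N /hX h.
apply: Rle_trans h _; apply: Rmult_le_compat_r; first exact: pos_INR.
have := hj j (PeanoNat.Nat.le_refl j) => /Rlt_le /Rabs_le_inv [_ h].
by rewrite /Rmax; case: Rle_dec; lra.
Qed.

(** * From psi to theta *)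

Definition theta (N : nat) : R := \rsum_(p <= N) (if prime p then lnn p else 0).

Lemma theta0 : theta 0 = 0.
Proof. exact: rsum0. Qed.

Lemma thetaS n : theta n.+1 = theta n + (if prime n.+1 then lnn n.+1 else 0).
Proof. exact: rsumS. Qed.

Lemma theta_mono m n : (m <= n)%N -> theta m <= theta n.
Proof.
elim: n => [|n IH]; first by case: m => // _; lra.
rewrite leq_eqVlt => /orP[/eqP->|mn]; first lra.
by rewrite thetaS; have := IH mn; have := lnn_ge0 n.+1; case: ifP; lra.
Qed.

Lemma theta_le_psi N : theta N <= psi N.
Proof.
apply: ler_rsum => n _; case: ifP => pn; last exact: Lam_ge0.
by rewrite -{2}(expn1 n) Lam_pfactor //; lra.
Qed.

(** Only powers p^k with k >= 2 remain. They have p <= M and k <= L, and each contributes at most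
    log N. *)
Lemma psi_sub_theta N M L : (0 < N)%N -> (N < M.+1 * M.+1)%N -> (N < 2 ^ L.+1)%N ->
  psi N - theta N <= INR M * INR L * lnn N.
Proof.
move=> N0 NM NL; rewrite -rsumB.
pose I (b : bool) : R := if b then 1 else 0.
apply: Rle_trans (_ : \rsum_(n <= N) \rsum_(p <= M) \rsum_(k <= L) (I (n == p ^ k)%N * lnn N) <= _).
  have I0 b : 0 <= I b by case: b; rewrite /I; lra.
  have lN := lnn_ge0 N.
  apply: ler_rsum => n hn.
  have pos : 0 <= \rsum_(p <= M) \rsum_(k <= L) (I (n == p ^ k)%N * lnn N).
    by do 2![apply: rsum_ge0 => ? _]; apply: Rmult_le_pos.
  case: ifP => np; first by rewrite -{1}(expn1 n) Lam_pfactor //; lra.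
  case: (LamP n) => [->|[p [k [pp [nE L1]]]]]; first lra.
  rewrite L1 Rminus_0_r.
  have k0 : (0 < k)%N by case: k nE => // nE; rewrite nE expn1 pp in np.
  have pM : (0 < p <= M)%N.
    rewrite prime_gt0 //= -ltnS; have p2 : (p * p <= N)%N.
      apply: leq_trans (_ : n <= _)%N; last lia.
      rewrite nE -(prednK k0) !expnS mulnA leq_pmulr // expn_gt0 prime_gt0 //.
    rewrite ltnNge; apply/negP => Mp; have := leq_mul Mp Mp; lia.
  have kL : (0 < k.+1 <= L)%N.
    rewrite /= -ltnS -(@ltn_exp2l 2) //; apply: leq_ltn_trans NL.
    apply: leq_trans (_ : n <= _)%N; last lia.
    by rewrite nE leq_exp2r // prime_gt1.
  apply: Rle_trans (_ : \rsum_(p' <= M) (if p' == p then lnn N else 0) <= _).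
    rewrite (rsum_single (fun=> lnn N) pM) -L1.
    by apply: Rle_trans (Lam_le n) _; apply: lnn_mono; lia.
  apply: ler_rsum => p' _; case: eqP => [->|_]; last first.
    by apply: rsum_ge0 => ? _; apply: Rmult_le_pos.
  rewrite -[X in X <= _](rsum_single (fun=> lnn N) kL); apply: ler_rsum => k' _.
  case: eqP => [->|_]; last by apply: Rmult_le_pos.
  by rewrite -nE eqxx /I; lra.
rewrite rsum_exchange Rmult_assoc -rsum_const; apply: ler_rsum => p hp.
rewrite rsum_exchange -rsum_const; apply: ler_rsum => k hk.
have lN := lnn_ge0 N.
case: (leqP (p ^ k) N) => pk.
  rewrite -[X in _ <= X](@rsum_single N (p ^ k) (fun=> lnn N)); last first.
    by rewrite pk expn_gt0; lia.
  by right; apply: eq_rsum => n _; rewrite /I; case: eqP => _; lra.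
rewrite (@eq_rsum _ _ (fun=> 0)) ?rsum_const; first lra.
by move=> n hn; rewrite /I; case: eqP => [e|_]; [lia | lra].
Qed.

Lemma ln_sqr_sublinear e : 0 < e -> exists X, forall n, (X <= n)%N ->
  lnn n * lnn n * sqrt (INR n) <= e * INR n.
Proof.
(* With u = n^(1/4): ln n = 4 ln u <= 8 sqrt u, so ln^2 n sqrt n <= 64 u^3, while n = u^4. *)
move=> e0; have [X [X0 hX]] := nat_above ((64 / e) ^ 4); exists X => n Xn.
have n1 := @INR_ge1 n ltac:(lia); have hn := leq_INR Xn.
set s := sqrt (INR n); set u := sqrt s.
have ss : s * s = INR n by apply: sqrt_sqrt; lra.
have s1 : 1 <= s by rewrite -sqrt_1; apply: sqrt_le_1_alt.
have uu : u * u = s by apply: sqrt_sqrt; lra.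
have u1 : 1 <= u by rewrite -sqrt_1; apply: sqrt_le_1_alt.
have lE : lnn n = 4 * ln u.
  by rewrite -ss -uu !ln_mult; nra.
have lu := @ln_le_2sqrt u ltac:(lra); have lu0 := ln_ge0 u1.
have qq := @sqrt_sqrt u ltac:(lra); have q0 := sqrt_pos u.
have l2 : lnn n * lnn n <= 64 * u by rewrite lE; nra.
have ue : 64 <= e * u.
  have h : (64 / e) <= u.
    apply: Rnot_lt_le => h; have h0 : 0 <= 64 / e by apply: Rle_mult_inv_pos; lra.
    have : u ^ 4 <= (64 / e) ^ 4 by apply: pow_incr; lra.
    have -> : u ^ 4 = INR n by rewrite -ss -uu; ring.
    lra.
  have -> : 64 = e * (64 / e) by field; lra.
  by apply: Rmult_le_compat_l; lra.
apply: Rle_trans (_ : 64 * u * s <= _); first by apply: Rmult_le_compat_r; lra.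
rewrite -ss -{2}uu; have : 64 * (u * s) <= e * u * (u * s); last lra.
by apply: Rmult_le_compat_r; nra.
Qed.

Theorem theta_asymp e : 0 < e ->
  exists X, forall N, (X <= N)%N -> Rabs (theta N - INR N) <= e * INR N.
Proof.
move=> e0; have [X1 h1] := @psi_asymp (e / 2) ltac:(lra).
have [X2 h2] := @ln_sqr_sublinear (e / 4) ltac:(lra).
exists (X1 + X2 + 1)%N => N hN; have /Rabs_le_inv b1 := h1 N ltac:(lia).
have N0 : (0 < N)%N by lia.
have n1 := INR_ge1 N0.
have b2 := h2 N ltac:(lia); have b3 := theta_le_psi N.
have [m1 m2] := PeanoNat.Nat.sqrt_spec N (PeanoNat.Nat.le_0_l N).
set M := PeanoNat.Nat.sqrt N in m1 m2.
have /andP[l1 l2] := trunc_log_bounds (isT : (1 < 2)%N) N0.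
set L := trunc_log 2 N in l1 l2.
have b4 := @psi_sub_theta N M L N0 ltac:(lia) l2.
have Ms : INR M <= sqrt (INR N).
  rewrite -(sqrt_square (INR M)); last exact: pos_INR.
  by apply: sqrt_le_1_alt; rewrite -INR_muln; apply: leq_INR; lia.
have Ll : INR L <= 2 * lnn N.
  have h : lnn (2 ^ L) <= lnn N by apply: lnn_mono; rewrite ?expn_gt0.
  have E j : lnn (2 ^ j) = INR j * lnn 2.
    elim: j => [|j IH]; first by rewrite /= ln_1; lra.
    by rewrite expnS lnn_muln ?expn_gt0 // IH (S_INR j); lra.
  rewrite E in h; have : / 2 < lnn 2 := ln_lt_2; have := pos_INR L; nra.
have lN := lnn_ge0 N; have L0 := pos_INR L; have M0 := pos_INR M.
have b5 : INR M * INR L * lnn N <= 2 * (lnn N * lnn N * sqrt (INR N)).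
  apply: Rle_trans (_ : sqrt (INR N) * (2 * lnn N) * lnn N <= _); last lra.
  by apply: Rmult_le_compat_r => //; apply: Rmult_le_compat.
by apply: Rabs_le; lra.
Qed.

Lemma prime_between m n : theta m < theta n -> exists p, prime p /\ (m < p <= n)%N.
Proof.
elim: n => [|n IH].
  by have := @theta_mono 0 m isT; lra.
rewrite thetaS; case: ifP => pn; last first.
  by rewrite Rplus_0_r => /IH[p [pp hp]]; exists p; split=> //; lia.
case: (leqP m n) => mn; first by exists n.+1; split=> //; lia.
by have := @theta_mono n.+1 m mn; rewrite thetaS pn; lra.
Qed.

(** * Schemmel totients and exchange of prime factors *)

Local Open Scope nat_scope.

Lemma Sr_gt0 r n : 0 < n -> (0 < Sr r n) = all (fun p => r < p) (primes n).
Proof.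
move=> n0; rewrite /Sr gtn_eqF //.
elim: (primes n) => [|p s IH] /=; first by rewrite big_nil.
rewrite big_cons muln_gt0 IH; congr (_ && _).
by case: (leqP p r) => // rp; rewrite muln_gt0 expn_gt0 subn_gt0 rp; lia.
Qed.

Lemma inBP r n : reflect (0 < n /\ forall p, prime p -> p %| n -> r < p) (inB r n).
Proof.
rewrite /inB; case: posnP => [-> /=|n0]; first by constructor; case.
rewrite Sr_gt0 //=; apply: (iffP allP) => [h|[_ h] p].
  by split=> // p pp pn; apply: h; rewrite mem_primes pp n0 pn.
by rewrite mem_primes => /andP[pp /andP[_]]; apply: h.
Qed.

Lemma inB_mul r m n : inB r m -> inB r n -> inB r (m * n).
Proof.
move=> /inBP[m0 hm] /inBP[n0 hn]; apply/inBP; rewrite muln_gt0 m0 n0; split=> // p pp.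
by rewrite Euclid_dvdM // => /orP[]; [apply: hm | apply: hn].
Qed.

Lemma inB_dvd r m n : inB r n -> m %| n -> inB r m.
Proof.
move=> /inBP[n0 hn] mn; apply/inBP; split=> [|p pp pm]; first exact: dvdn_gt0 mn.
by apply: hn => //; apply: dvdn_trans mn.
Qed.

(** Together with [Sr_mul_ndvd] this is the form of multiplicativity used when prime factors are
    exchanged one at a time. *)
Lemma Sr_mul_dvd r p n : prime p -> 0 < n -> p %| n -> Sr r (p * n) = p * Sr r n.
Proof.
move=> pp n0 pn; have p0 := prime_gt0 pp.
have pin : p \in primes n by rewrite mem_primes pp n0 pn.
have l0 : 0 < logn p n by rewrite logn_gt0.
rewrite /Sr muln_eq0 !gtn_eqF //= primes_mul_dvd //.
rewrite !(bigD1_seq p pin) ?primes_uniq //= mulnA; congr (_ * _).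
  case: ifP => _; first by rewrite muln0.
  by rewrite logn_mul_prime // eqxx add1n /= mulnA -expnS prednK.
by apply: eq_bigr => q qp; rewrite logn_mul_prime // (negbTE qp).
Qed.

Lemma Sr_mul_ndvd r p n : prime p -> 0 < n -> ~~ (p %| n) -> Sr r (p * n) = (p - r) * Sr r n.
Proof.
move=> pp n0 pn; have p0 := prime_gt0 pp.
rewrite /Sr muln_eq0 !gtn_eqF //= (perm_big _ (primes_mul_ndvd pp n0 pn)) big_cons.
congr (_ * _).
  rewrite logn_mul_prime // eqxx lognE (negbTE pn) !andbF /= mul1n.
  (* For p <= r the truncated difference p - r is 0, in agreement with the definition of S_r. *)
  by case: leqP => // /eqP.
apply: eq_big_seq => q; rewrite mem_primes => /andP[_ /andP[_ qn]].
by rewrite logn_mul_prime // (_ : (q == p) = false) //; apply: contraNF pn => /eqP<-.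
Qed.

Lemma Sr_mul_prime_le r p n : prime p -> 0 < n -> Sr r (p * n) <= p * Sr r n.
Proof.
move=> pp n0; case: (boolP (p %| n)) => pn; first by rewrite Sr_mul_dvd.
by rewrite Sr_mul_ndvd // leq_mul2r leq_subr orbT.
Qed.

Lemma Sr_mul_prime_ge r p n : prime p -> 0 < n -> (p - r) * Sr r n <= Sr r (p * n).
Proof.
move=> pp n0; case: (boolP (p %| n)) => pn; last by rewrite Sr_mul_ndvd.
by rewrite Sr_mul_dvd // leq_mul2r leq_subr orbT.
Qed.

Lemma Sr_mul_le r n b : 0 < n -> 0 < b -> Sr r (n * b) <= Sr r n * b.
Proof.
move=> n0; move: b; apply: prime_nat_ind => [|p b pp b0 IH]; first by rewrite !muln1.
rewrite mulnCA; apply: leq_trans (Sr_mul_prime_le _ pp _) _; first by rewrite muln_gt0 n0.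
by rewrite mulnCA leq_mul2l IH orbT.
Qed.

Lemma prod_primes_gt0 (s : seq nat) : all prime s -> 0 < \prod_(p <- s) p.
Proof.
move=> /allP h; rewrite big_seq; apply: prodn_cond_gt0 => p /h; exact: prime_gt0.
Qed.

Lemma Sr_mul_prod_ge r m ps : 0 < m -> all prime ps ->
  Sr r m * \prod_(p <- ps) (p - r) <= Sr r (m * \prod_(p <- ps) p).
Proof.
move=> m0; elim: ps => [|p ps IH] /=; first by rewrite !big_nil !muln1.
case/andP=> pp ap; rewrite !big_cons mulnCA [m * _]mulnCA.
apply: leq_trans (Sr_mul_prime_ge _ pp _); last by rewrite muln_gt0 m0 prod_primes_gt0.
by rewrite leq_mul2l IH ?orbT.
Qed.

Lemma Sr_mul_prod_uniq r m qs : 0 < m -> all prime qs -> uniq qs ->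
  all (fun q => ~~ (q %| m)) qs ->
  Sr r (m * \prod_(q <- qs) q) = Sr r m * \prod_(q <- qs) (q - r).
Proof.
move=> m0; elim: qs => [|q qs IH] /=; first by rewrite !big_nil !muln1.
case/andP=> qp aq /andP[qnq uq] /andP[qm am]; rewrite !big_cons mulnCA [Sr r m * _]mulnCA.
rewrite Sr_mul_ndvd ?IH // ?muln_gt0 ?m0 ?prod_primes_gt0 //.
rewrite Euclid_dvdM // (negbTE qm) /=.
elim: qs {IH am uq} qnq aq => [|q' qs IH]; first by rewrite big_nil dvdn1; case: q qp {qm} => [|[]].
rewrite inE negb_or /= big_cons => /andP[qq' qn] /andP[q'p aq].
by rewrite Euclid_dvdM // negb_or dvdn_prime2 // qq' IH.
Qed.

Lemma inB_prod r qs : all prime qs -> all (fun q => r < q) qs -> inB r (\prod_(q <- qs) q).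
Proof.
elim: qs => [|q qs IH] /=.
  by rewrite big_nil => _ _; apply/inBP; split=> // -[|[]].
case/andP=> qp aq /andP[rq ar]; rewrite big_cons; apply: inB_mul; last exact: IH.
by apply/inBP; split=> [|p pp]; [exact: prime_gt0 | rewrite dvdn_prime2 // => /eqP->].
Qed.

(** With n = m prod(ps), the number m prod(qs) t lies in B_r and exceeds n, so S_r increases.
    Removing [ps] divides S_r by at least prod(p - r), inserting the new primes multiplies it by
    exactly prod(q - r), and t by at most t; the factor S_r(m) cancels. *)
Lemma inF_exchange r n ps qs t : inF r n ->
  all prime ps -> \prod_(p <- ps) p %| n ->
  all prime qs -> uniq qs -> all (fun q => r < q) qs -> all (fun q => ~~ (q %| n)) qs ->
  inB r t -> \prod_(p <- ps) p < (\prod_(q <- qs) q) * t ->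
  \prod_(p <- ps) (p - r) < (\prod_(q <- qs) (q - r)) * t.
Proof.
move=> [Bn Fn] pp /dvdnP[m nE] qp uq rq qn Bt lt.
have n0 : 0 < n by case/inBP: Bn.
have m0 : 0 < m by move: n0; rewrite nE muln_gt0 => /andP[].
have t0 : 0 < t by case/inBP: Bt.
have Bm : inB r m by apply: inB_dvd Bn _; rewrite nE dvdn_mulr.
have Q0 := prod_primes_gt0 qp.
have Bn' : inB r (m * \prod_(q <- qs) q * t).
  by apply: inB_mul => //; apply: inB_mul => //; apply: inB_prod.
have := Fn _ Bn' ltac:(by rewrite nE -mulnA ltn_pmul2l) => lt'.
have := leq_trans lt' (Sr_mul_le _ _ t0); rewrite muln_gt0 m0 Q0 => /(_ isT).
rewrite Sr_mul_prod_uniq //; last first.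
  by apply/allP => q /(allP qn); apply: contra => qm; rewrite nE dvdn_mulr.
rewrite nE => /(leq_ltn_trans (Sr_mul_prod_ge r m0 pp)).
by rewrite -mulnA ltn_mul2l => /andP[].
Qed.

(** Being coprime to r# is membership in B_r for positive integers; the J consecutive integers start
    at x + 1. *)
Lemma covers_inB r J x : covers (primorial r) J -> exists t, x < t <= x + J /\ inB r t.
Proof.
move=> /(_ (Z.of_nat x.+1)) [i [iJ]]; rewrite -Nat2Z.inj_add => g1.
exists (x.+1 + i); split; first lia.
apply/inBP; split=> // p pp pt; rewrite ltnNge; apply/negP => pr.
have pP : p %| primorial r.
  rewrite /primorial; have pr1 : p < r.+1 by [].
  by rewrite (bigD1 (Ordinal pr1)) //= dvdn_mulr.
have dvdZ a b : a %| b -> (Z.of_nat a | Z.of_nat b)%Z.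
  by case/dvdnP=> c ->; exists (Z.of_nat c); rewrite Nat2Z.inj_mul.
have := Z.gcd_greatest _ _ _ (dvdZ _ _ pt) (dvdZ _ _ pP).
rewrite g1 => /Z.divide_1_r_nonneg h; have := prime_gt1 pp; have := h ltac:(lia); lia.
Qed.

(** * Primes above r that do not divide n *)

Lemma next_nondiv_primeP n m (q := next_nondiv_prime n m) : 0 < n ->
  [/\ m < q, prime q, ~~ (q %| n) & forall p, m < p -> prime p -> ~~ (p %| n) -> q <= p].
Proof.
move=> n0; rewrite /q /next_nondiv_prime; case: ex_minnP => x.
rewrite gtn_eqF //= => /and3P[mx px xn] h; split=> // p mp pp pn.
by apply: h; rewrite mp pp pn.
Qed.

Lemma Qk0 r n : Qk r 0 n = r. Proof. by []. Qed.

Lemma QkS r k n : Qk r k.+1 n = next_nondiv_prime n (Qk r k n). Proof. by []. Qed.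

Lemma Qk_lt r n i j : 0 < n -> i < j -> Qk r i n < Qk r j n.
Proof.
move=> n0; elim: j => // j IH; rewrite ltnS leq_eqVlt QkS.
have [h _ _ _] := next_nondiv_primeP (Qk r j n) n0.
by case/orP=> [/eqP->|/IH]; [| move=> h'; apply: ltn_trans h' h].
Qed.

Lemma Qk_le r n i j : 0 < n -> i <= j -> Qk r i n <= Qk r j n.
Proof. by move=> n0; rewrite leq_eqVlt => /orP[/eqP->|/(Qk_lt r n0)/ltnW]. Qed.

Lemma Qk_gt r n k : 0 < n -> r < Qk r k.+1 n.
Proof. by move=> n0; rewrite -{1}(Qk0 r n); apply: Qk_lt. Qed.

Lemma Qk_prime r n k : 0 < n -> prime (Qk r k.+1 n).
Proof. by move=> n0; case: (next_nondiv_primeP (Qk r k n) n0). Qed.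

Lemma Qk_ndvd r n k : 0 < n -> ~~ (Qk r k.+1 n %| n).
Proof. by move=> n0; case: (next_nondiv_primeP (Qk r k n) n0). Qed.

Definition Qseq r K n := [seq Qk r i.+1 n | i <- iota 0 K].

Lemma Qseq_props r K n : 0 < n -> [/\ all prime (Qseq r K n), uniq (Qseq r K n),
  all (fun q => r < q) (Qseq r K n) & all (fun q => ~~ (q %| n)) (Qseq r K n)].
Proof.
move=> n0; split.
- by apply/allP => q /mapP[i _ ->]; apply: Qk_prime.
- rewrite map_inj_in_uniq ?iota_uniq // => i j _ _ /eqP; case: (ltngtP i j) => // ij.
  + by have /(Qk_lt r n0) : i.+1 < j.+1 by []; rewrite ltn_neqAle => /andP[/negbTE->].
  + by have /(Qk_lt r n0) : j.+1 < i.+1 by []; rewrite ltn_neqAle eq_sym => /andP[/negbTE->].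
- by apply/allP => q /mapP[i _ ->]; apply: Qk_gt.
- by apply/allP => q /mapP[i _ ->]; apply: Qk_ndvd.
Qed.

Local Open Scope R_scope.

(* Pushing x down to a while keeping x * y fixed increases (x + r) * (y + r), because
   (x - a) * (y - a) >= 0. *)
Lemma prod_shift_le (r y : R) (x a : nat -> R) k : 0 <= r ->
  (forall i, (i < k)%N -> 0 < a i <= x i) -> (forall i, (i < k)%N -> a i <= y) -> 0 < y ->
  y <= y * \big[Rmult/1]_(0 <= i < k) (x i / a i) /\
  \big[Rmult/1]_(0 <= i < k) (x i + r) * (y + r) <=
  \big[Rmult/1]_(0 <= i < k) (a i + r) * (y * \big[Rmult/1]_(0 <= i < k) (x i / a i) + r).
Proof.
move=> r0; elim: k => [|k IH] xa ya y0; first by rewrite !big_geq //; lra.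
have [IH1 IH2] := IH (fun i hi => xa i (ltnW hi)) (fun i hi => ya i (ltnW hi)) y0.
rewrite !big_nat_recr //=.
have := xa k (leqnn _); have := ya k (leqnn _).
move: (x k) (a k) => xk ak yk [ak0 xk1].
set Y := (y * _) in IH1 IH2; set X := \big[Rmult/1]_(0 <= i < k) (x i + r) in IH2 *.
set A := \big[Rmult/1]_(0 <= i < k) (a i + r) in IH2 *.
rewrite -Rmult_assoc -/Y.
have A0 : 0 <= A.
  rewrite /A big_nat; apply: (big_ind (fun z => 0 <= z)); first lra.
    by move=> u v; apply: Rmult_le_pos.
  by move=> i hi; have := xa i ltac:(lia); lra.
have q1 : 1 <= xk / ak by apply: (Rmult_le_reg_r ak) => //; field_simplify; lra.
split; first by nra.
have key : (xk + r) * (Y + r) <= (ak + r) * (Y * (xk / ak) + r).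
  have E : Y * (xk / ak) - Y - xk + ak = (xk - ak) * (Y - ak) / ak by field; lra.
  have : 0 <= (xk - ak) * (Y - ak) / ak.
    by apply: Rle_mult_inv_pos => //; apply: Rmult_le_pos; lra.
  have : ak * (Y * (xk / ak)) = xk * Y by field; lra.
  nra.
have s1 : X * (xk + r) * (y + r) <= A * (xk + r) * (Y + r).
  have : X * (y + r) * (xk + r) <= A * (Y + r) * (xk + r) by apply: Rmult_le_compat_r; lra.
  lra.
have := Rmult_le_compat_l A _ _ A0 key; lra.
Qed.

Lemma INR_prod k (f : nat -> nat) :
  INR (\prod_(0 <= i < k) f i) = \big[Rmult/1]_(0 <= i < k) INR (f i).
Proof. exact: (big_morph INR INR_muln). Qed.

(** [prod_shift_le] with x_i = P_i - r, a_i = q_i - r and y = P_k - r: lowering each P_i with i < k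
    to q_i and moving the lost mass of prod(P_i - r) to the last factor can only increase prod(P_i),
    and the last factor then becomes at most q'. *)
Lemma prod_shift_nat r q' k (P q : nat -> nat) :
  (forall i, i <= k -> r < q i <= P i)%N -> (forall i, i < k -> P i < P k)%N -> (r < q')%N ->
  (\prod_(0 <= i < k.+1) (P i - r) <= (\prod_(0 <= i < k) (q i - r)) * (q' - r))%N ->
  (\prod_(0 <= i < k.+1) P i <= (\prod_(0 <= i < k) q i) * q')%N.
Proof.
move=> qP Pk rq' le.
have Isub a : (r <= a)%N -> INR (a - r) = (INR a - INR r) by move=> h; apply: minus_INR; lia.
pose x i := INR (P i - r); pose a i := INR (q i - r).
have a0 i : (i <= k)%N -> (0 < a i <= x i).
  move=> ik; have := qP i ik => h; split.
    by apply: (ltn_INR (m := 0)); lia.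
  by apply: leq_INR; lia.
have yk : 0 < x k by have := a0 k (leqnn k); lra.
have [|| _ h] := @prod_shift_le (INR r) (x k) x a k (pos_INR r) _ _ yk.
- by move=> i ik; apply: a0; lia.
- move=> i ik; have := a0 i ltac:(lia); have : x i <= x k; last lra.
  by apply: leq_INR; have := Pk i ik; lia.
have e1 i : (i <= k)%N -> (x i + INR r = INR (P i)).
  by move=> ik; rewrite /x Isub; [lra | have := qP i ik; lia].
have e2 i : (i <= k)%N -> (a i + INR r = INR (q i)).
  by move=> ik; rewrite /a Isub; [lra | have := qP i ik; lia].
rewrite (@eq_big_nat _ _ _ 0 k (fun i => x i + INR r) (fun i => INR (P i))) in h; last first.
  by move=> i hi; apply: e1; lia.
rewrite (@eq_big_nat _ _ _ 0 k (fun i => a i + INR r) (fun i => INR (q i))) in h; last first.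
  by move=> i hi; apply: e2; lia.
rewrite (e1 k) // -!INR_prod -INR_muln -big_nat_recr // in h.
apply/leP; apply: INR_le.
apply: Rle_trans h _; rewrite INR_muln; apply: Rmult_le_compat_l; first exact: pos_INR.
have -> : INR q' = (INR (q' - r) + INR r) by rewrite Isub; [lra | lia].
apply: Rplus_le_compat_r.
have A0 : 0 < INR (\prod_(0 <= i < k) (q i - r)%N).
  apply: (ltn_INR (m := 0)); rewrite big_nat; apply: prodn_cond_gt0 => i hi.
  by have := qP i ltac:(lia); lia.
have E : INR (\prod_(0 <= i < k) (q i - r)%N) * \big[Rmult/1]_(0 <= i < k) (x i / a i) =
   \big[Rmult/1]_(0 <= i < k) x i.
  rewrite INR_prod -big_split /=; apply: eq_big_nat => i hi.
  by rewrite -/(a i) /Rdiv; field; have := a0 i ltac:(lia); lra.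
apply: (Rmult_le_reg_l _ _ _ A0).
rewrite -INR_muln [(x k * _)]Rmult_comm -Rmult_assoc E -INR_prod /x -INR_muln.
by apply: leq_INR; move: le; rewrite big_nat_recr.
Qed.

Local Open Scope nat_scope.

(** No prime divides 1, so [Qk r i.+1 1] is q_i, the prime of index i (from 0) among all primes
    above r. *)
Lemma Qk1_le_nth r s i : sorted ltn s -> all prime s -> all (fun p => r < p) s ->
  i < size s -> Qk r i.+1 1 <= nth 0 s i.
Proof.
move=> ss /allP ps /allP rs.
have ndvd p : prime p -> ~~ (p %| 1) by rewrite dvdn1; case: p => [|[]].
elim: i => [|i IH] hi; have hin := mem_nth 0 hi.
  have [_ _ _ h] := next_nondiv_primeP r (isT : 0 < 1).
  by apply: h; [apply: rs | apply: ps | apply/ndvd/ps].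
have [_ _ _ h] := next_nondiv_primeP (Qk r i.+1 1) (isT : 0 < 1).
apply: h; [| by apply: ps | by apply/ndvd/ps].
apply: leq_ltn_trans (IH (ltnW hi)) _.
by apply: (sorted_ltn_nth ltn_trans) => //; rewrite inE //; exact: ltnW.
Qed.

(** c is n divided by its radical: the surplus powers p^(a-1) enter n and S_r(n) alike. *)
Lemma Sr_decomp r n : inB r n -> exists c, [/\ 0 < c, n = c * \prod_(p <- primes n) p &
  Sr r n = c * \prod_(p <- primes n) (p - r)].
Proof.
move=> /inBP[n0 hn]; exists (\prod_(p <- primes n) p ^ (logn p n).-1).
have pr p : p \in primes n -> prime p by rewrite mem_primes => /andP[].
split; first by rewrite big_seq; apply: prodn_cond_gt0 => p /pr pp; rewrite expn_gt0 prime_gt0.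
- rewrite -big_split /= {1}(prod_prime_decomp n0) prime_decompE big_map /=.
  apply: eq_big_seq => p pn; rewrite -expnSr prednK //.
  by rewrite logn_gt0.
rewrite /Sr gtn_eqF // -big_split; apply: eq_big_seq => p pn.
rewrite leqNgt hn //; first exact: pr.
by move: pn; rewrite mem_primes => /and3P[].
Qed.

(* A competitor m with S_r(m) <= S_r(n) and k + 1 prime factors must be squarefree, since
   otherwise S_r(m) >= 2 prod_(i <= k) (q_i - r) > S_r(n); then prod_shift_nat applies. *)
Lemma inF_family r k q' (q := fun i => Qk r i.+1 1) :
  prime q' -> q k < q' -> q' - r < 2 * (q k - r) ->
  inF r (q' * \prod_(0 <= i < k) q i).
Proof.
move=> q'p qq' q'2.
have rq i : r < q i by apply: Qk_gt.
have qi i j : i < j -> q i < q j by move=> ij; apply: Qk_lt.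
have [Qp Qu Qr _] := Qseq_props r k (isT : 0 < 1).
pose qs := q' :: Qseq r k 1.
have qsp : all prime qs by rewrite /= q'p.
have qsu : uniq qs.
  rewrite /= Qu andbT; apply/negP => /mapP[i]; rewrite mem_iota => /andP[_ ik] e.
  by have := qi i k ik; rewrite /q -e => h; have := ltn_trans h qq'; rewrite ltnn.
have qsr : all (fun q => r < q) qs by rewrite /= Qr andbT; apply: ltn_trans (rq k) qq'.
have nE f : \prod_(p <- qs) f p = f q' * \prod_(0 <= i < k) f (q i).
  by rewrite big_cons /Qseq big_map /index_iota subn0.
have Bn : inB r (q' * \prod_(0 <= i < k) q i) by rewrite -(nE id); apply: inB_prod.
have Sn : Sr r (q' * \prod_(0 <= i < k) q i) = (q' - r) * \prod_(0 <= i < k) (q i - r).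
  rewrite -(nE id) -(nE (fun p => p - r)) -[\prod_(p <- qs) p]mul1n Sr_mul_prod_uniq //.
    by rewrite /Sr /= big_nil mul1n.
  by apply/allP => p /(allP qsp); rewrite dvdn1; case: p => [|[]].
split=> // m Bm nm; rewrite ltnNge; apply/negP => SmSn.
rewrite Sn in SmSn.
have [c [c0 mE Sm]] := Sr_decomp Bm.
have [m0 hm] := inBP _ _ Bm.
set s := primes m in mE Sm; pose P i := nth 0 s i; pose j := size s.
have Pin i : i < j -> P i \in s by apply: mem_nth.
have sp : all prime s by apply/allP => p; rewrite mem_primes => /andP[].
have sr : all (fun p => r < p) s.
  by apply/allP => p; rewrite mem_primes => /and3P[pp _]; apply: hm.
have ss : sorted ltn s by apply: sorted_primes.
have qP i : i < j -> q i <= P i by apply: Qk1_le_nth.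
have sE f : \prod_(p <- s) f p = \prod_(0 <= i < j) f (P i) by rewrite (big_nth 0).
rewrite (sE id) in mE; rewrite (sE (fun p => p - r)) in Sm.
have A0 : 0 < \prod_(0 <= i < k) (q i - r) by apply: prodn_gt0 => i; rewrite subn_gt0.
have low l : l <= j -> \prod_(0 <= i < l) (q i - r) <= \prod_(0 <= i < j) (P i - r).
  move=> lj; rewrite (big_cat_nat (n := l) (p := j)) //= -[X in X <= _]muln1.
  apply: leq_mul.
    rewrite big_nat [X in _ <= X]big_nat.
    by apply: leq_prod => i /andP[_ il]; rewrite leq_sub2r // qP // (leq_trans il).
  rewrite big_nat; apply: prodn_cond_gt0 => i /andP[_ ij].
  by rewrite subn_gt0; apply: leq_trans (rq i) (qP i ij).
have contra2 : 2 * \prod_(0 <= i < k.+1) (q i - r) <= Sr r m -> False.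
  rewrite big_nat_recr //= => h; have := leq_trans h SmSn.
  by rewrite mulnCA mulnC leq_mul2r gtn_eqF //= leqNgt q'2.
case: (ltngtP j k.+1) => jk.
(* At most k prime factors: 1 - r/P_i >= 1 - r/q_i makes S_r(m)/m at least prod_(i<k) (1 - r/q_i),
   so S_r(m) <= S_r(n) gives m <= (q' - r) prod_(i<k) q_i, which does not exceed n. *)
- have h : (\prod_(0 <= i < j) P i) * (\prod_(0 <= i < k) (q i - r)) <=
           (\prod_(0 <= i < j) (P i - r)) * (\prod_(0 <= i < k) q i).
    have jk' : j <= k by [].
    rewrite !(big_cat_nat (m := 0) (n := j) (p := k)) //= !mulnA; apply: leq_mul.
      rewrite -!big_split /= big_nat [X in _ <= X]big_nat; apply: leq_prod => i /andP[_ ij].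
      by rewrite mulnBr mulnBl; apply: leq_sub2l; rewrite mulnC leq_mul2r qP ?orbT.
    by apply: leq_prod => i _; apply: leq_subr.
  have := leq_mul (leqnn c) h; rewrite !mulnA -mE -Sm => h1.
  have := leq_trans h1 (leq_mul SmSn (leqnn _)).
  rewrite mulnAC leq_mul2r gtn_eqF //= => h2.
  have := leq_trans nm h2; rewrite ltnNge leq_mul2r leq_subr orbT //.
(* At least k + 2 prime factors: q_(k+1) > q_k > r, so the additional factor q_(k+1) - r is at least
   2. *)
- apply: contra2; rewrite Sm.
  apply: leq_trans (_ : \prod_(0 <= i < k.+2) (q i - r) <= _).
    rewrite [X in _ <= X]big_nat_recr //= mulnC leq_mul2l; apply/orP; right.
    by rewrite ltn_subRL addn1; apply: leq_ltn_trans (rq k) (qi k k.+1 (leqnn _)).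
  apply: leq_trans (low k.+2 jk) _; exact: leq_pmull.
case: (ltnP 1 c) => c1.
  by apply: contra2; rewrite Sm -jk; apply: leq_mul => //; apply: low.
have c1' : c = 1 by apply/eqP; rewrite eqn_leq c1.
rewrite c1' !mul1n in mE Sm; rewrite jk in mE Sm.
suff : m <= q' * \prod_(0 <= i < k) q i by rewrite leqNgt nm.
rewrite mE mulnC; apply: (@prod_shift_nat r) => //.
- by move=> i ik; rewrite rq qP // jk.
- by move=> i ik; apply: (sorted_ltn_nth ltn_trans) => //; rewrite inE -/j jk // ltnW.
- by apply: ltn_trans (rq k) qq'.
- by rewrite -Sm mulnC.
Qed.

Local Open Scope R_scope.

(** The prime divisors are among the prime power divisors, whose Lambda values sum to log n. *)
Lemma rsum_ln_prime_divisors n y : (0 < n)%N ->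
  \rsum_(p <= y) (if prime p && (p %| n)%N then lnn p else 0) <= lnn n.
Proof.
move=> n0; pose f p := if prime p && (p %| n)%N then lnn p else 0.
rewrite -[X in X <= _]/(\rsum_(p <= y) f p).
have f0 i : 0 <= f i by rewrite /f; case: ifP => _; [apply: lnn_ge0 | lra].
apply: Rle_trans (_ : \rsum_(p <= maxn y n) f p <= _).
  have := @ler_rsum_diff y (maxn y n) (fun=> 0) f (leq_maxl _ _) (fun i _ => f0 i).
  by rewrite !rsum_const; lra.
rewrite (@rsum_widen n (maxn y n)) ?leq_maxr //; last first.
  by move=> i hi; rewrite /f; case: ifP => // /andP[_ /dvdn_leq]; lia.
rewrite -rsum_Lam_dvd //; apply: ler_rsum => p _; rewrite /f.
case: (boolP (prime p)) => pp /=; last by case: ifP => _; [apply: Lam_ge0 | lra].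
by case: ifP => _; [rewrite -{2}(expn1 p) Lam_pfactor //; lra | lra].
Qed.

Lemma theta_Qk_le r n L : (0 < n)%N ->
  theta (Qk r L n) <= theta r + lnn n + INR L * lnn (Qk r L n).
Proof.
move=> n0; pose f p := if prime p && (p %| n)%N then lnn p else 0.
have f0 i : 0 <= f i by rewrite /f; case: ifP => _; [apply: lnn_ge0 | lra].
suff : theta (Qk r L n) <= theta r + \rsum_(p <= Qk r L n) f p + INR L * lnn (Qk r L n).
  have : \rsum_(p <= Qk r L n) f p <= lnn n := rsum_ln_prime_divisors _ n0.
  by lra.
elim: L => [|L IH].
  by rewrite Qk0 /=; have := @rsum_ge0 r f (fun i _ => f0 i); lra.
have [lt pq _ min] := next_nondiv_primeP (Qk r L n) n0; rewrite -QkS in lt pq min.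
have mono : INR L * lnn (Qk r L n) <= INR L * lnn (Qk r L.+1 n).
  apply: Rmult_le_compat_l; first exact: pos_INR.
  case: (posnP (Qk r L n)) => [->|Q0]; last by apply: lnn_mono => //; apply: ltnW.
  by rewrite lnn0; apply: lnn_ge0.
case: (Qk r L.+1 n) lt pq min mono => // q lt pq min mono.
have d := @ler_rsum_diff (Qk r L n) q (fun p => if prime p then lnn p else 0) f lt.
rewrite thetaS pq rsumS (S_INR L); have := f0 q.+1.
have : theta q - theta (Qk r L n) <= \rsum_(p <= q) f p - \rsum_(p <= Qk r L n) f p; last lra.
apply: d => i hi; rewrite /f; case: ifP => pi /=; last lra.
case: (boolP (i %| n)%N) => ni; first lra.
by have := min i ltac:(lia) pi ni; lia.
Qed.

(** * Limits superior *)

Lemma Qk_upper r L e : 0 < e -> exists N, forall n, (N <= n)%N ->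
  (0 < n)%N /\ INR (Qk r L n) <= (1 + e) * lnn n.
Proof.
(* Small enough for 1 + d <= (1 - 2 d)(1 + e). *)
move=> e0; pose d := Rmin e 1 / 10.
have d0 : 0 < d by rewrite /d; have := Rmin_glb_lt e 1 0 ltac:(lra) ltac:(lra); lra.
have [d1 d2] : d <= e / 10 /\ d <= / 10.
  by rewrite /d; have := Rmin_l e 1; have := Rmin_r e 1; lra.
have [X1 h1] := theta_asymp d0.
have L0 := pos_INR L.
have [X2 [X20 h2]] := @lnn_sublinear (d / (INR L + 1)) ltac:(apply: Rdiv_lt_0_compat; lra).
pose X := (X1 + X2)%N.
have [N [N0 hN]] := lnn_unbounded (INR X + theta r / d + 1).
exists N => n Nn; have n0 : (0 < n)%N by lia.
split=> //; have ln := hN n Nn; set Q := Qk r L n.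
have t0 : 0 <= theta r by rewrite -theta0; apply: theta_mono.
have td : 0 <= theta r / d by apply: Rle_mult_inv_pos.
have X0 := pos_INR X.
case: (leqP X Q) => QX; last first.
  by have := ltn_INR QX; nra.
have /Rabs_le_inv a1 := h1 Q ltac:(lia); have a2 := h2 Q ltac:(lia).
have a3 := theta_Qk_le r L n0; rewrite -/Q in a3.
have Q0 := pos_INR Q.
have a4 : INR L * lnn Q <= d * INR Q.
  apply: Rle_trans (_ : (INR L + 1) * (d / (INR L + 1) * INR Q) <= _); last by right; field; lra.
  by apply: Rmult_le_compat => //; [apply: lnn_ge0 | lra].
have a5 : theta r <= d * lnn n.
  have -> : theta r = d * (theta r / d) by field; lra.
  by apply: Rmult_le_compat_l; lra.
have l1 : 1 <= lnn n by lra.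
have b : (1 - 2 * d) * INR Q <= (1 + d) * lnn n by lra.
have c : (1 + d) * lnn n <= (1 - 2 * d) * ((1 + e) * lnn n).
  by rewrite -Rmult_assoc; apply: Rmult_le_compat_r; nra.
by apply: (Rmult_le_reg_l (1 - 2 * d)); lra.
Qed.

Lemma mem_Pk k n : (0 < k <= omega n)%N -> Pk k n \in primes n.
Proof.
move=> /andP[k0 kn]; rewrite /Pk -mem_rev; apply: mem_nth; rewrite size_rev -/(omega n); lia.
Qed.

Lemma sorted_rev_primes n : sorted geq (rev (primes n)).
Proof. by rewrite rev_sorted; apply: sub_sorted (sorted_primes n) => x y /ltnW. Qed.

Lemma nth_rev_primes_ge n i j : (i <= j < omega n)%N ->
  (nth 0 (rev (primes n)) j <= nth 0 (rev (primes n)) i)%N.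
Proof.
move=> /andP[ij jn].
have geq_trans : transitive geq by move=> y x z /= h1 h2; apply: leq_trans h2 h1.
apply: (sorted_leq_nth geq_trans _ _ (sorted_rev_primes n)) => //; first exact: leqnn.
  by rewrite inE size_rev -/(omega n); lia.
by rewrite inE size_rev -/(omega n).
Qed.

Lemma Pk1_ge n p : p \in primes n -> (p <= Pk 1 n)%N.
Proof.
rewrite -mem_rev => /(nthP 0%N)[i]; rewrite size_rev => hi <-.
exact: nth_rev_primes_ge.
Qed.

Lemma dvdn_prod_Qk1 r k p : prime p -> (r < p)%N -> (p < Qk r k.+1 1)%N ->
  (p %| \prod_(0 <= i < k) Qk r i.+1 1)%N.
Proof.
move=> pp rp; have pn : ~~ (p %| 1)%N by rewrite dvdn1; case: p pp {rp} => [|[]].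
elim: k => [|k IH] lt.
  have [_ _ _ h] := next_nondiv_primeP r (isT : (0 < 1)%N).
  by have := h p rp pp pn; rewrite leqNgt lt.
have [_ _ _ h] := next_nondiv_primeP (Qk r k.+1 1) (isT : (0 < 1)%N).
rewrite big_nat_recr //=; case: (ltngtP p (Qk r k.+1 1)) => c.
- by rewrite dvdn_mulr ?IH.
- by have := h p c pp pn; rewrite leqNgt lt.
- by rewrite c dvdn_mull.
Qed.

Lemma lnn_prod_Qk1_le r k : lnn (\prod_(0 <= i < k) Qk r i.+1 1) <= theta (Qk r k 1).
Proof.
elim: k => [|k IH].
  by rewrite big_geq // lnn1 -theta0; apply: theta_mono.
have qp := Qk_prime r k (isT : (0 < 1)%N); have lt := @Qk_lt r 1 k k.+1 isT (leqnn _).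
have P0 : (0 < \prod_(0 <= i < k) Qk r i.+1 1)%N.
  by apply: prodn_gt0 => i; apply: prime_gt0; apply: Qk_prime.
have -> : (\prod_(0 <= i < k.+1) Qk r i.+1 1 = (\prod_(0 <= i < k) Qk r i.+1 1) * Qk r k.+1 1)%N.
  by rewrite big_nat_recr.
rewrite lnn_muln ?(prime_gt0 qp) //.
case: (Qk r k.+1 1) qp lt => // q qp lt; rewrite thetaS qp.
by have := @theta_mono (Qk r k 1) q lt; lra.
Qed.

(** With x = q_k, log n <= theta(x) + log q' is at most (1 + 2 d) x, whereas P_1(n) >= q' is nearly
    2 x, and Q_1(n) >= x because every prime between r and x divides n. *)
Lemma inF_family_asymp r e N : 0 < e <= 1 -> exists n, [/\ (N <= n)%N, inF r n, 0 < lnn n,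
  (2 - e) * lnn n < INR (Pk 1 n) & (1 - e) * lnn n < INR (Qk r 1 n)].
Proof.
move=> [e0 e1]; have [D [D0 hD]] := nat_above (10 / e).
have D1 := INR_ge1 D0; pose d := / INR D.
have d0 : 0 < d by apply: Rinv_0_lt_compat; lra.
have d1 : 10 * d < e.
  have : 10 / e * (e * d) < INR D * (e * d) by apply: Rmult_lt_compat_r => //; nra.
  have -> : 10 / e * (e * d) = 10 * d by field; lra.
  by have -> : INR D * (e * d) = e by rewrite /d; field; lra.
have [X1 h1] := @theta_asymp (d / 8) ltac:(lra).
have [X2 [X20 h2]] := @lnn_sublinear (d / 2) ltac:(lra).
(* Since q_k > k, this makes x exceed every threshold; the term 2 D (r + 10) keeps r small against
   x/D. *)
pose k := (X1 + X2 + N + 2 * D * (r + 10) + r + 10)%N.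
pose q i := Qk r i.+1 1; pose x := q k.
have qk i : (i <= Qk r i 1)%N.
  by elim: i => // i IH; apply: leq_ltn_trans IH _; apply: Qk_lt.
have kx : (k < x)%N by apply: qk.
have x0 : (0 < x)%N by lia.
have x1 := INR_ge1 x0.
(* The cut at 2 x - r - 1 is the largest q' with q' - r < 2 (x - r). The errors of theta at m and M
   total at most x/(2 D), less than M - m, so a prime lies between them. *)
pose m := (2 * x - x %/ D)%N; pose M := (2 * x - r.+1)%N.
have xD : (x %/ D <= x)%N by apply: leq_div.
have mE : INR m = 2 * INR x - INR (x %/ D).
  by rewrite /m minus_INR; [rewrite mult_INR /=; lra | lia].
have ME : INR M = 2 * INR x - INR r - 1.
  by rewrite /M minus_INR; [rewrite mult_INR (S_INR r) /=; lra | lia].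
have f1 := INR_divn_le x D0; have f2 := INR_divn_gt x D0.
rewrite /Rdiv -/d in f1 f2.
have xr : 2 * (INR r + 10) <= INR x * d.
  have : INR (2 * D * (r + 10)) <= INR x by apply: leq_INR; rewrite /k in kx; lia.
  rewrite !INR_muln INR_addn => h.
  have -> : 2 * (INR r + 10) = (INR 2 * INR D * (INR r + INR 10)) * d by rewrite /d /=; field; lra.
  by apply: Rmult_le_compat_r; lra.
have r0 := pos_INR r.
have tm : theta m < theta M.
  have /Rabs_le_inv a1 := h1 m ltac:(lia); have /Rabs_le_inv a2 := h1 M ltac:(lia).
  have : (1 + d / 8) * INR m < (1 - d / 8) * INR M; last lra.
  rewrite mE ME; have d2 : d <= 1 by lra.
  nra.
have [q' [q'p /andP[mq' q'M]]] := prime_between tm.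
have xq' : (x < q')%N by lia.
have Fn : inF r (q' * \prod_(0 <= i < k) q i).
  have q'2 : (q' - r < 2 * (x - r))%N by lia.
  exact: inF_family.
set n := (q' * \prod_(0 <= i < k) q i)%N in Fn.
have P0 : (0 < \prod_(0 <= i < k) q i)%N.
  by apply: prodn_gt0 => i; apply: prime_gt0; apply: Qk_prime.
have n0 : (0 < n)%N by rewrite muln_gt0 P0 prime_gt0.
have q'n : (q' <= n)%N by rewrite leq_pmulr.
have ln : lnn n <= (1 + 2 * d) * INR x.
  rewrite lnn_muln ?(prime_gt0 q'p) //.
  have a1 : lnn (\prod_(0 <= i < k) q i) <= theta (Qk r k 1) := lnn_prod_Qk1_le r k.
  have a2 := @theta_mono (Qk r k 1) x ltac:(apply: Qk_le => //).
  have /Rabs_le_inv a3 := h1 x ltac:(lia).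
  have a4 := @h2 q' ltac:(lia).
  have a5 : INR q' <= 2 * INR x by rewrite -[2]/(INR 2) -INR_muln; apply: leq_INR; lia.
  have : d / 2 * INR q' <= d / 2 * (2 * INR x) by apply: Rmult_le_compat_l; lra.
  have : 0 <= d * INR x by nra.
  lra.
exists n; split=> //.
- lia.
- rewrite -ln_1; apply: ln_increasing; first lra.
  by have := @ltn_INR 1 n ltac:(lia); rewrite /=; lra.
- have : INR q' <= INR (Pk 1 n).
    by apply: leq_INR; apply: Pk1_ge; rewrite mem_primes q'p n0 dvdn_mulr.
  have := ltn_INR mq'; rewrite mE => b1 b2.
  have : (2 - e) * lnn n <= (2 - e) * ((1 + 2 * d) * INR x) by apply: Rmult_le_compat_l; lra.
  nra.
have : INR x <= INR (Qk r 1 n).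
  apply: leq_INR; rewrite leqNgt; apply/negP => lt.
  have := dvdn_prod_Qk1 (Qk_prime r 0 n0) (Qk_gt r 0 n0) lt.
  by move=> /(dvdn_mull q'); rewrite -/n (negbTE (Qk_ndvd r 0 n0)).
have : (1 - e) * lnn n <= (1 - e) * ((1 + 2 * d) * INR x) by apply: Rmult_le_compat_l; lra.
nra.
Qed.

(** * Inequalities between the largest prime factors and the smallest missing primes *)

Lemma inF_exchange_real r n J ps qs : inF r n -> covers (primorial r) J ->
  all prime ps -> (\prod_(p <- ps) p %| n)%N ->
  all prime qs -> uniq qs -> all (fun q => r < q)%N qs -> all (fun q => ~~ (q %| n))%N qs ->
  INR (\prod_(p <- ps) (p - r)%N) <
  INR (\prod_(q <- qs) (q - r)%N) * (INR (\prod_(p <- ps) p) / INR (\prod_(q <- qs) q) + INR J).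
Proof.
move=> Fn cov pp pn qp uq rq qn; have Q0 := prod_primes_gt0 qp.
have [t [tJ Bt]] := covers_inB ((\prod_(p <- ps) p) %/ (\prod_(q <- qs) q)) cov.
have lt : (\prod_(p <- ps) p < (\prod_(q <- qs) q) * t)%N.
  by rewrite mulnC -ltn_divLR //; case/andP: tJ.
have := ltn_INR (inF_exchange Fn pp pn qp uq rq qn Bt lt); rewrite INR_muln => h.
apply: Rlt_le_trans h _; apply: Rmult_le_compat_l; first exact: pos_INR.
have := @leq_INR t _ (proj2 (andP tJ)); rewrite INR_addn.
by have := INR_divn_le (\prod_(p <- ps) p) Q0; lra.
Qed.

Lemma omega_gt0 n : (1 < n)%N -> (0 < omega n)%N.
Proof.
move=> n1; have : pdiv n \in primes n by rewrite mem_primes pdiv_prime // pdiv_dvd ltnW.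
by rewrite /omega; case: (primes n).
Qed.

(** Exchanging P for Q t gives (P - r) Q < (Q - r)(P + J Q), that is, r P < J Q^2 - r Q (J - 1).
    Besides (d), this bounds all prime factors of n once Q_1 is bounded, as (c) requires. *)
Lemma Pk1_le_Qk1_sqr r n J : (0 < r)%N -> (0 < J)%N -> inF r n -> (1 < n)%N -> covers (primorial r) J ->
  INR (Pk 1 n) <= INR J / INR r * INR (Qk r 1 n) ^ 2.
Proof.
move=> r0 J0 Fn n1 cov; have n0 : (0 < n)%N by lia.
have := @mem_Pk 1 n; rewrite omega_gt0 // => /(_ isT).
rewrite mem_primes => /and3P[Pp _ Pn]; set P := Pk 1 n in Pp Pn *; set Q := Qk r 1 n.
have Qp := Qk_prime r 0 n0; have Qn := Qk_ndvd r 0 n0; have Qr := Qk_gt r 0 n0.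
rewrite -/Q in Qp Qn Qr.
have Pr : (r < P)%N by have [_ h] := inBP _ _ (proj1 Fn); apply: h.
have := @inF_exchange_real r n J [:: P] [:: Q] Fn cov.
rewrite !big_seq1 /= Pp Pn Qp Qr Qn => /(_ isT isT isT isT isT isT).
rewrite !minus_INR; try lia.
have r1 := INR_ge1 r0; have J1 := INR_ge1 J0; have Q1 := ltn_INR Qr; have P1 := ltn_INR Pr.
move=> h; have : (INR P - INR r) * INR Q < (INR Q - INR r) * (INR P / INR Q + INR J) * INR Q.
  by apply: Rmult_lt_compat_r; lra.
have -> : (INR Q - INR r) * (INR P / INR Q + INR J) * INR Q =
   (INR Q - INR r) * (INR P + INR J * INR Q) by field; lra.
have h3 : 0 <= INR r * INR Q * (INR J - 1) by do 2![apply: Rmult_le_pos; try lra].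
move=> h2; have h4 : INR r * INR P <= INR J * INR Q ^ 2 by lra.
apply: (Rmult_le_reg_l (INR r)); first lra.
have -> : INR r * (INR J / INR r * INR Q ^ 2) = INR J * INR Q ^ 2 by field; lra.
exact: h4.
Qed.

(** Bernoulli's inequality (1 - u)^s >= 1 - s u for u = r/P, as every 1 - r/p is at least 1 - u. *)
Lemma prod_sub_ge r P s : (r < P)%N -> all (fun p => P <= p)%N s ->
  (1 - INR (size s) * (INR r / INR P)) * INR (\prod_(p <- s) p) <= INR (\prod_(p <- s) (p - r)%N).
Proof.
move=> rP; have P0 := @ltn_INR r P rP; have r0 := pos_INR r.
set u := INR r / INR P.
have u0 : 0 <= u by apply: Rle_mult_inv_pos; lra.
have uP : u * INR P = INR r by rewrite /u; field; lra.
elim: s => [|p s IH]; first by rewrite !big_nil /=; lra.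
move=> /andP[Pp /IH {}IH]; rewrite !big_cons !INR_muln -[size (p :: s)]/(size s).+1.
have Pp1 := leq_INR Pp.
rewrite minus_INR; last lia.
set A := INR (\prod_(j <- s) (j - r)%N) in IH *; set B := INR (\prod_(j <- s) j) in IH *.
have A0 : 0 <= A by apply: pos_INR.
have B0 : 0 <= B by apply: pos_INR.
have k0 := pos_INR (size s); set k := INR (size s) in IH k0 *.
have -> : INR (size s).+1 = k + 1 by rewrite S_INR.
have u1 : u <= 1 by nra.
have p0 : 0 <= INR p by lra.
have s1 : INR p * (1 - u) * A <= (INR p - INR r) * A by apply: Rmult_le_compat_r => //; nra.
have s2 : INR p * (1 - u) * ((1 - k * u) * B) <= INR p * (1 - u) * A.
  by apply: Rmult_le_compat_l => //; apply: Rmult_le_pos; lra.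
have s3 : 0 <= INR p * B * (k * u * u).
  by apply: Rmult_le_pos; apply: Rmult_le_pos => //; apply: Rmult_le_pos.
lra.
Qed.

(** Every 1 - r/q is at most 1 - u with u = r/Q, and (1 - u)(1 + (k + 1) u) <= 1 + k u carries the
    induction. *)
Lemma prod_sub_le r Q s : (r < Q)%N -> all (fun q => r < q <= Q)%N s ->
  INR (\prod_(q <- s) (q - r)%N) * (1 + INR (size s) * (INR r / INR Q)) <= INR (\prod_(q <- s) q).
Proof.
move=> rQ; have Q0 := @ltn_INR r Q rQ; have r0 := pos_INR r.
set u := INR r / INR Q.
have u0 : 0 <= u by apply: Rle_mult_inv_pos; lra.
have uQ : u * INR Q = INR r by rewrite /u; field; lra.
elim: s => [|q s IH]; first by rewrite !big_nil /=; lra.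
move=> /andP[/andP[rq qQ] /IH {}IH]; rewrite !big_cons !INR_muln -[size (q :: s)]/(size s).+1.
have qQ1 := leq_INR qQ; have rq1 := ltn_INR rq.
rewrite minus_INR; last lia.
set A := INR (\prod_(j <- s) (j - r)%N) in IH *; set B := INR (\prod_(j <- s) j) in IH *.
have A0 : 0 <= A by apply: pos_INR.
have k0 := pos_INR (size s); set k := INR (size s) in IH k0 *.
have -> : INR (size s).+1 = k + 1 by rewrite S_INR.
have q0 : 0 <= INR q by lra.
have s1 : (INR q - INR r) * (A * (1 + (k + 1) * u)) <= INR q * (1 - u) * (A * (1 + (k + 1) * u)).
  by apply: Rmult_le_compat_r; [apply: Rmult_le_pos => //; nra | nra].
have s2 : INR q * (A * (1 + k * u)) <= INR q * B by apply: Rmult_le_compat_l.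
have s3 : 0 <= INR q * A * ((k + 1) * u * u).
  by apply: Rmult_le_pos; apply: Rmult_le_pos => //; apply: Rmult_le_pos; lra.
lra.
Qed.

Lemma INR_prod_ge P s : all (fun p => P <= p)%N s -> INR P ^ size s <= INR (\prod_(p <- s) p).
Proof.
elim: s => [|p s IH]; first by rewrite big_nil /=; lra.
rewrite /= => /andP[/leq_INR Pp /IH {}IH]; rewrite big_cons INR_muln.
by apply: Rmult_le_compat => //; [apply: pos_INR | apply: pow_le; apply: pos_INR].
Qed.

Lemma INR_prod_le Q s : all (fun q => q <= Q)%N s -> INR (\prod_(q <- s) q) <= INR Q ^ size s.
Proof.
elim: s => [|q s IH]; first by rewrite big_nil /=; lra.
rewrite /= => /andP[/leq_INR qQ /IH {}IH]; rewrite big_cons INR_muln.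
by apply: Rmult_le_compat => //; apply: pos_INR.
Qed.

(** The k + 1 largest primes, all >= P, are exchanged for Q_1, ..., Q_k, all <= Q, and a filler. The
    last term bounds the relative overshoot J prod(q)/prod(p) of the filler. *)
Lemma Pk_Qk_ineq r n J k (P := Pk k.+1 n) (Q := Qk r k n) :
  (0 < r)%N -> (0 < k)%N -> inF r n -> (k < omega n)%N -> covers (primorial r) J ->
  (1 - INR k.+1 * (INR r / INR P)) * (1 + INR k * (INR r / INR Q)) <
  1 + INR J * INR Q ^ k / INR P ^ k.+1.
Proof.
move=> r0 k0 Fn kn cov; have [Bn _] := Fn; have [n0 hn] := inBP _ _ Bn.
pose s := rev (primes n); pose ps := take k.+1 s; pose qs := Qseq r k n.
have [qp qu qr qn] := Qseq_props r k n0.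
have sps : size ps = k.+1 by rewrite size_takel // size_rev.
have sqs : size qs = k by rewrite size_map size_iota.
have psp : all prime ps.
  by apply/allP => p /mem_take; rewrite mem_rev mem_primes => /andP[].
have psn : (\prod_(p <- ps) p %| n)%N.
  have [c [_ nE _]] := Sr_decomp Bn.
  rewrite [X in (_ %| X)%N]nE dvdn_mull //.
  have -> : (\prod_(p <- primes n) p = \prod_(p <- s) p)%N.
    by apply: perm_big; rewrite perm_sym perm_rev.
  by rewrite -(cat_take_drop k.+1 s) big_cat /= dvdn_mulr.
have psP : all (fun p => P <= p)%N ps.
  apply/(all_nthP 0%N) => i; rewrite sps => ik; rewrite nth_take //.
  by apply: nth_rev_primes_ge; lia.
have Pin : P \in primes n by apply: mem_Pk.
have rP : (r < P)%N.
  by move: Pin; rewrite mem_primes => /and3P[pp _ pn]; apply: hn.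
have rQ : (r < Q)%N by rewrite /Q -(prednK k0); apply: Qk_gt.
have qsQ : all (fun q => r < q <= Q)%N qs.
  apply/allP => q qin; rewrite (allP qr q qin) /=.
  by move: qin => /mapP[i]; rewrite mem_iota => /andP[_ ik] ->; apply: Qk_le.
have h := inF_exchange_real Fn cov psp psn qp qu qr qn.
have h1 := prod_sub_ge rP psP; have h2 := prod_sub_le rQ qsQ.
have h3 := INR_prod_ge psP.
have h4 : INR (\prod_(q <- qs) q) <= INR Q ^ size qs.
  by apply: INR_prod_le; apply: sub_all qsQ => q /andP[].
rewrite sps in h1 h3; rewrite sqs in h2 h4.
set a := 1 - _ in h1 *; set b := 1 + INR k * _ in h2 *.
have PP1 := INR_ge1 (prod_primes_gt0 psp); have QQ1 := INR_ge1 (prod_primes_gt0 qp).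
rewrite -/ps -/qs in h PP1 QQ1.
set PP := INR (\prod_(p <- ps) p) in h h1 h3 PP1; set QQ := INR (\prod_(q <- qs) q) in h h2 h4 QQ1.
set A := INR (\prod_(p <- ps) (p - r)%N) in h h1; set B := INR (\prod_(q <- qs) (q - r)%N) in h h2.
have P1 := INR_ge1 (leq_ltn_trans (leq0n r) rP); have Q1 := INR_ge1 (leq_ltn_trans (leq0n r) rQ).
have b1 : 0 < b.
  rewrite /b; have : 0 <= INR k * (INR r / INR Q); last lra.
  by apply: Rmult_le_pos (pos_INR _) _; apply: Rle_mult_inv_pos; [apply: pos_INR | lra].
have J0 := pos_INR J.
have s1 : a * b * PP < PP + INR J * QQ.
  have t1 : b * (a * PP) <= b * A by apply: Rmult_le_compat_l; lra.
  have t2 : b * A < b * (B * (PP / QQ + INR J)) by apply: Rmult_lt_compat_l.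
  have t3 : B * b * (PP / QQ + INR J) <= QQ * (PP / QQ + INR J).
    apply: Rmult_le_compat_r => //; have : 0 <= PP / QQ by apply: Rle_mult_inv_pos; lra.
    lra.
  have E : QQ * (PP / QQ + INR J) = PP + INR J * QQ by field; lra.
  lra.
have s2 : INR J * QQ / PP <= INR J * INR Q ^ k / INR P ^ k.+1.
  have Pk0 : 0 < INR P ^ k.+1 by apply: pow_lt; lra.
  apply: Rmult_le_compat; [nra | | exact: Rmult_le_compat_l | exact: Rinv_le_contravar].
  by left; apply: Rinv_0_lt_compat; lra.
apply: Rlt_le_trans (_ : 1 + INR J * QQ / PP <= _); last lra.
apply: (Rmult_lt_reg_r PP); first lra.
by have -> : (1 + INR J * QQ / PP) * PP = PP + INR J * QQ by field; lra.
Qed.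

(** With u = r/Q one has r/P = x u, and the overshoot is (J/r) x^(k+1) u; expanding and dividing by
    u leaves the polynomial of lambda_(k+1)(r) and an error term of order x/Q. *)
Lemma Pk_Qk_poly r n J k (P := Pk k.+1 n) (Q := Qk r k n) (x := INR Q / INR P) :
  (0 < r)%N -> (0 < k)%N -> inF r n -> (k < omega n)%N -> covers (primorial r) J ->
  INR k < INR J / INR r * x ^ k.+1 + INR k.+1 * x + INR k.+1 * INR k * x * (INR r / INR Q).
Proof.
move=> r0 k0 Fn kn cov; have h := Pk_Qk_ineq r0 k0 Fn kn cov; rewrite -/P -/Q in h.
have [n0 hn] := inBP _ _ (proj1 Fn).
have r1 := INR_ge1 r0.
have rQ : (r < Q)%N by rewrite /Q -(prednK k0); apply: Qk_gt.
have Pp : (0 < P)%N.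
  by have := @mem_Pk k.+1 n kn; rewrite mem_primes => /andP[/prime_gt0].
have P1 := INR_ge1 Pp; have Q1 := ltn_INR rQ.
set u := INR r / INR Q in h *.
have u0 : 0 < u by apply: Rdiv_lt_0_compat; lra.
have e1 : INR r / INR P = x * u by rewrite /x /u; field; lra.
have e2 : INR J * INR Q ^ k / INR P ^ k.+1 = INR J / INR r * x ^ k.+1 * u.
  rewrite /x /u /Rdiv Rpow_mult_distr pow_inv /=; field.
  by repeat split; try lra; apply: pow_nonzero; lra.
rewrite e1 e2 in h; apply: (Rmult_lt_reg_r u) => //; lra.
Qed.

(** * The bounds (a) to (d) *)

Lemma Rdiv_lt_of x l c : 0 < l -> x < c * l -> x / l < c.
Proof.
move=> l0 h; apply: (Rmult_lt_reg_r l) => //.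
by have -> : x / l * l = x by field; lra.
Qed.

Lemma Rlt_div_of x l c : 0 < l -> c * l < x -> c < x / l.
Proof.
move=> l0 h; apply: (Rmult_lt_reg_r l) => //.
by have -> : x / l * l = x by field; lra.
Qed.

Lemma limsup_Pk1_ge r : limsup_ge (inF r) (fun n => INR (Pk 1 n) / lnn n) 2.
Proof.
move=> eps eps0 N; have [n [Nn Fn l0 h _]] := @inF_family_asymp r (Rmin eps 1) N
  ltac:(split; [apply: Rmin_glb_lt; lra | apply: Rmin_r]).
exists n; split=> //; split=> //; apply: Rlt_div_of => //; apply: Rle_lt_trans h.
by apply: Rmult_le_compat_r; have := Rmin_l eps 1; lra.
Qed.

Lemma limsup_Qk_ge r L : (0 < L)%N -> limsup_ge (inF r) (fun n => INR (Qk r L n) / lnn n) 1.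
Proof.
move=> L0 eps eps0 N; have [n [Nn Fn l0 _ h]] := @inF_family_asymp r (Rmin eps 1) N
  ltac:(split; [apply: Rmin_glb_lt; lra | apply: Rmin_r]).
exists n; split=> //; split=> //; apply: Rlt_div_of => //.
have n0 : (0 < n)%N by case/inBP: (proj1 Fn).
have := leq_INR (Qk_le r n0 L0).
have : (1 - eps) * lnn n <= (1 - Rmin eps 1) * lnn n; last lra.
by apply: Rmult_le_compat_r; have := Rmin_l eps 1; lra.
Qed.

Lemma limsup_Qk_le r L : limsup_le (inF r) (fun n => INR (Qk r L n) / lnn n) 1.
Proof.
move=> eps eps0; have [N1 h1] := @Qk_upper r L (eps / 2) ltac:(lra).
have [N2 [N20 h2]] := lnn_unbounded 1.
exists (N1 + N2)%N => n hn _; have [_ h] := h1 n ltac:(lia); have l1 := h2 n ltac:(lia).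
by apply: Rdiv_lt_of; nra.
Qed.

Lemma limsup_Pk1_le r J : (0 < r)%N -> (0 < J)%N -> covers (primorial r) J ->
  limsup_le (inF r) (fun n => INR (Pk 1 n) / lnn n ^ 2) (INR J / INR r).
Proof.
move=> r0 J0 cov eps eps0; set c := INR J / INR r.
have c0 : 0 < c by apply: Rdiv_lt_0_compat; [have := INR_ge1 J0 | have := INR_ge1 r0]; lra.
(* As d <= 1, c (1 + d)^2 <= c + 3 c d, which stays below c + eps. *)
pose d := Rmin 1 (eps / (4 * c)).
have d0 : 0 < d by apply: Rmin_glb_lt; [lra | apply: Rdiv_lt_0_compat; lra].
have d1 : d <= 1 by apply: Rmin_l.
have d2 : c * d <= eps / 4.
  have -> : eps / 4 = c * (eps / (4 * c)) by field; lra.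
  by apply: Rmult_le_compat_l; [lra | apply: Rmin_r].
have [N1 h1] := @Qk_upper r 1 d d0.
have [N2 [N20 h2]] := lnn_unbounded 1.
exists (N1 + N2 + 2)%N => n hn Fn; have [_ h] := h1 n ltac:(lia); have l1 := h2 n ltac:(lia).
have := Pk1_le_Qk1_sqr r0 J0 Fn ltac:(lia) cov; rewrite -/c => hP.
apply: Rdiv_lt_of; first by apply: pow_lt; lra.
apply: Rle_lt_trans hP _.
have q2 : INR (Qk r 1 n) ^ 2 <= ((1 + d) * lnn n) ^ 2.
  by apply: pow_incr; split=> //; apply: pos_INR.
have q3 := Rmult_le_compat_l c _ _ (Rlt_le _ _ c0) q2.
apply: Rle_lt_trans q3 _; rewrite Rpow_mult_distr -Rmult_assoc.
apply: Rmult_lt_compat_r; first by apply: pow_lt; lra.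
nra.
Qed.

(** Here k is K - 1. A large P_K would push x = Q/P below lam by a fixed gap, where the polynomial
    falls short of K - 1; only the error term could compensate, and that is possible for bounded Q
    alone. *)
Lemma limsup_Pk_le r J k lam : (0 < r)%N -> (0 < J)%N -> (0 < k)%N -> covers (primorial r) J ->
  0 < lam -> INR J / INR r * lam ^ k.+1 + INR k.+1 * lam = INR k ->
  limsup_le (fun n => inF r n /\ (k < omega n)%N) (fun n => INR (Pk k.+1 n) / lnn n) (/ lam).
Proof.
move=> r0 J0 k0 cov lam0 root eps eps0; set c := INR J / INR r in root.
have r1 := INR_ge1 r0; have k1 := INR_ge1 k0.
have c0 : 0 < c by apply: Rdiv_lt_0_compat; [have := INR_ge1 J0 | ]; lra.
have le0 : 0 < lam * eps by apply: Rmult_lt_0_compat.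
(* P_K >= (1/lam + eps) log n and Q <= (1 + d) log n give Q/P_K <= x0, and d < lam eps makes x0 <
   lam. *)
pose d := lam * eps / 2; pose x0 := lam * (1 + d) / (1 + lam * eps).
have gap : 0 < lam - x0.
  have -> : lam - x0 = lam * d / (1 + lam * eps) by rewrite /x0 /d; field; lra.
  by apply: Rdiv_lt_0_compat; [apply: Rmult_lt_0_compat => // | ]; rewrite /d; lra.
pose Qb := INR k * lam * INR r / (lam - x0).
have [N1 h1] := @Qk_upper r k d ltac:(rewrite /d; lra).
have [N2 [N20 h2]] := lnn_unbounded (lam * (c * Qb ^ 2) + 1).
exists (N1 + N2 + 2)%N => n hn [Fn kn].
have [n0 hQ] := h1 n ltac:(lia); have l1 := h2 n ltac:(lia).
have Qb2 : 0 <= lam * (c * Qb ^ 2).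
  by apply: Rmult_le_pos; [lra | apply: Rmult_le_pos; [lra | apply: pow2_ge_0]].
set l := lnn n in hQ l1 *; set P := Pk k.+1 n; set Q := Qk r k n in hQ.
apply: Rdiv_lt_of; first lra.
apply: Rnot_le_lt => hP.
have rQ : (r < Q)%N by rewrite /Q -(prednK k0); apply: Qk_gt.
have Q1 := ltn_INR rQ.
have Pin : P \in primes n by apply: mem_Pk.
have il0 := Rinv_0_lt_compat _ lam0.
have P0 : 0 < INR P.
  by apply: Rlt_le_trans hP; apply: Rmult_lt_0_compat; lra.
have poly := Pk_Qk_poly r0 k0 Fn kn cov.
rewrite -/P -/Q -/c in poly; set x := INR Q / INR P in poly.
have xx0 : x <= x0.
  apply: (Rmult_le_reg_r (INR P)) => //.
  have -> : x * INR P = INR Q by rewrite /x; field; lra.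
  apply: Rle_trans hQ _.
  have -> : (1 + d) * l = x0 * ((/ lam + eps) * l) by rewrite /x0; field; lra.
  apply: Rmult_le_compat_l => //.
  by apply: Rle_mult_inv_pos; [apply: Rmult_le_pos; rewrite /d; lra | lra].
have x1 : 0 <= x by apply: Rle_mult_inv_pos; lra.
have pw : x ^ k.+1 <= lam ^ k.+1 by apply: pow_incr; lra.
have pw2 := Rmult_le_compat_l c _ _ (Rlt_le _ _ c0) pw.
have K0 : 0 < INR k.+1 by rewrite S_INR; lra.
set u := INR r / INR Q in poly.
have u0 : 0 < u by apply: Rdiv_lt_0_compat; lra.
have b1 : INR k.+1 * x <= INR k.+1 * x0 by apply: Rmult_le_compat_l; lra.
have b2 : INR k.+1 * INR k * x * u <= INR k.+1 * INR k * lam * u.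
  apply: Rmult_le_compat_r; first lra.
  by apply: Rmult_le_compat_l; [apply: Rmult_le_pos | ]; lra.
have b3 : lam - x0 < INR k * lam * u.
  apply: (Rmult_lt_reg_l (INR k.+1)) => //; lra.
have b4 : INR Q < Qb.
  apply: (Rmult_lt_reg_r (lam - x0)) => //.
  have -> : Qb * (lam - x0) = INR k * lam * u * INR Q by rewrite /Qb /u; field; lra.
  by rewrite Rmult_comm; apply: Rmult_lt_compat_r; lra.
(* Q_1 <= Q < Qb bounds P_1 and hence P_K, whereas P_K >= (log n)/lam; the threshold N2 makes log n
   too large for that. *)
have b5 := Pk1_le_Qk1_sqr r0 J0 Fn ltac:(lia) cov; rewrite -/c in b5.
have b6 := leq_INR (Pk1_ge Pin).
have b7 : INR (Qk r 1 n) ^ 2 <= Qb ^ 2.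
  apply: pow_incr; split; first exact: pos_INR.
  by have := leq_INR (Qk_le r n0 k0); rewrite -/Q; lra.
have b8 := Rmult_le_compat_l c _ _ (Rlt_le _ _ c0) b7.
have b9 : / lam * l <= INR P by apply: Rle_trans hP; apply: Rmult_le_compat_r; lra.
have b10 : l <= lam * INR P.
  have -> : l = lam * (/ lam * l) by field; lra.
  by apply: Rmult_le_compat_l; lra.
have b11 : lam * INR P <= lam * (c * Qb ^ 2) by apply: Rmult_le_compat_l; lra.
lra.
Qed.

Theorem theorem3p3 (r K L : nat) (hr : (0 < r)%N) (hK : (2 <= K)%N) (hL : (0 < L)%N) :
  (* (a) limsup P_1(n)/log n >= 2 *)
  limsup_ge (inF r) (fun n => Rdiv (INR (Pk 1 n)) (ln (INR n))) (INR 2) /\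
  (* (b) limsup Q_L(n)/log n = 1 *)
  limsup_ge (inF r) (fun n => Rdiv (INR (Qk r L n)) (ln (INR n))) R1 /\
  limsup_le (inF r) (fun n => Rdiv (INR (Qk r L n)) (ln (INR n))) R1 /\
  (forall J : nat, is_jacobsthal (primorial r) J ->
    (* (c) lam = lambda_K(r), the unique positive root of (J_r/r) x^K + K x - (K-1) *)
    (forall lam : R, Rlt 0 lam ->
       Rminus (Rplus (Rmult (Rdiv (INR J) (INR r)) (pow lam K)) (Rmult (INR K) lam))
              (Rminus (INR K) R1) = R0 ->
       limsup_le (fun n => inF r n /\ (K <= omega n)%N)
                 (fun n => Rdiv (INR (Pk K n)) (ln (INR n))) (Rinv lam)) /\
    (* (d) limsup P_1(n)/log^2 n <= J_r / r *)
    limsup_le (inF r) (fun n => Rdiv (INR (Pk 1 n)) (pow (ln (INR n)) 2))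
              (Rdiv (INR J) (INR r))).
Proof.
split; first exact: limsup_Pk1_ge.
split; first exact: limsup_Qk_ge.
split; first exact: limsup_Qk_le.
move=> J [J0 [cov _]]; split=> [lam lam0 root|]; last exact: limsup_Pk1_le.
case: K hK root => [|k] // hk root; apply: (limsup_Pk_le hr J0) => //.
have {}root : INR J / INR r * lam ^ k.+1 + INR k.+1 * lam - (INR k.+1 - 1) = 0 := root.
by move: root; rewrite (S_INR k); lra.
Qed.
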